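(* Let $n$ and $s$ be integers with $n\ge s\ge 0$ and $4n/11\le s\le 3n/8$. Then $\mathrm{ex}(n,s)=6n^2-32ns+44s^2$.
   Context: All graphs are finite and simple. For integers $n\ge s\ge 0$, $\mathrm{ex}(n,s)$ denotes the maximum number of edges in a triangle-free graph on $n$ vertices containing no independent set with more than $s$ vertices. *)

(* Defs.v *)
From mathcomp Require Export all_boot all_order all_algebra.

Set Implicit Arguments.
Unset Strict Implicit.
Unset Printing Implicit Defensive.

(* A simple graph on V is given by its edge set, a set of 2-element subsets. *)
Definition simple_graph (V : finType) (E : {set {set V}}) : bool :=
  [forall e in E, #|e| == 2].

Definition adj (V : finType) (E : {set {set V}}) : rel V :=
  fun x y => [set x; y] \in E.

Definition triangle_free (V : finType) (E : {set {set V}}) : bool :=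
  ~~ [exists x, exists y, exists z, [&& adj E x y, adj E y z & adj E x z]].

Definition independent (V : finType) (E : {set {set V}}) (A : {set V}) : bool :=
  [forall x in A, forall y in A, ~~ adj E x y].

(* ex(n, s). The maximum over an empty family of graphs is 0 by convention, so a
   statement that ex_tf n s is positive includes the existence of such a graph. *)
Definition ex_tf (n s : nat) : nat :=
  \max_(E : {set {set 'I_n}} |
        [&& simple_graph E, triangle_free E
          & [forall A : {set 'I_n}, independent E A ==> (#|A| <= s)]]) #|E|.

(* Main.v *)
(** Write [n = 8 x + 3 y] and [s = 3 x + y] with [0 <= y <= x]; the claimed value is
    [12 x^2 + 8 x y + 2 y^2], attained by blowing up the circulant graph on Z/11 with
    connection set {4, 5, 6, 7}, three classes having size [y] and eight size [x].

    For the upper bound, suppose that the excess [F = (ex(n, s) - g(n, s)) / n^2] over the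
    claimed value [g(n, s)] is positive somewhere, and take a graph whose excess is almost
    maximal over all [n] and [s]. Perturb it by adding new vertices with an independent
    neighborhood [B] and by removing weight uniformly from a large set [Y]. No perturbation
    increases the excess substantially, so linear programming duality gives a random
    independent set [I] that avoids each independent [B] of size about [s] with probability
    at least about [rho], and contains the points of [Y], on average, with probability at
    most about [rho]; here [4/11 <= rho <= 3/8 - 2 F] comes from the prices of a vertex and
    of an increase of [s].

    The large independent sets disjoint from a given [A] nearly share a core of size at
    least about [3 s - n], so the probability of avoiding [A] is about [rho] for every
    large [A]. Hence disjointness is an almost regular relation of degree [rho] on the
    large independent sets, triangle-free since [3 s > n]. Sets with different
    neighborhoods have almost disjoint cores, an independent set contains at most three
    of them, and [3 / rho < 9]; the relation is thus almost a blow-up of a triangle-free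
    graph on at most eight vertices. Such a graph has no regular weighting with degree in
    [[4/11, 3/8[]: it is bipartite or contains a pentagon, and the finitely many extensions
    of the pentagon are excluded by explicit dual certificates. *)

Require Import Defs.
From mathcomp Require Import all_boot all_order all_algebra.
From mathcomp Require Import zify ring lra.
Import Order.TTheory GRing.Theory Num.Theory.
Local Open Scope ring_scope.

Set Implicit Arguments.
Unset Strict Implicit.
Unset Printing Implicit Defensive.

(** * Weighted graphs *)

Definition triangle_free_rel (T : Type) (e : rel T) : Prop :=
  forall x y z, e x y -> e y z -> ~~ e x z.

Definition indep_set (T : finType) (e : rel T) (A : {set T}) : bool :=
  [forall x in A, forall y in A, ~~ e x y].

Lemma indep_setP (T : finType) (e : rel T) (A : {set T}) :
  reflect {in A &, forall x y, ~~ e x y} (indep_set e A).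
Proof.
apply: (iffP forall_inP) => [indA x y /indA/forall_inP|indA x xA]; first exact.
by apply/forall_inP => y; apply: indA.
Qed.

Lemma indep_set0 (T : finType) (e : rel T) : indep_set e set0.
Proof. by apply/indep_setP => x y; rewrite inE. Qed.

Lemma triangle_free_irr (T : Type) (e : rel T) : triangle_free_rel e -> irreflexive e.
Proof. by move=> etf x; apply/negP => xx; have := etf x x x xx xx; rewrite xx. Qed.

Lemma indep_nbhd (T : finType) (e : rel T) (x : T) :
  triangle_free_rel e -> symmetric e -> indep_set e [set y | e x y].
Proof.
move=> etf esym; apply/indep_setP => y z; rewrite !inE => xy xz.
by apply: etf xz; rewrite esym.
Qed.

Lemma ler_psum_sub (R : numDomainType) (T : finType) (P Q : pred T) (l : T -> R) :
  (forall x, 0 <= l x) -> subpred P Q -> \sum_(x | P x) l x <= \sum_(x | Q x) l x.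
Proof.
move=> l_ge0 PQ; rewrite [leLHS]big_mkcond [leRHS]big_mkcond.
by apply: ler_sum => x _; case: ifP => [/PQ->|_] //; case: ifP.
Qed.

Lemma exchange_sum_adj (R : comPzRingType) (T : finType) (e : rel T) (P Q : pred T)
    (l m : T -> R) : symmetric e ->
  \sum_(x | P x) l x * (\sum_(y | Q y && e x y) m y) =
  \sum_(y | Q y) m y * (\sum_(x | P x && e y x) l x).
Proof.
move=> esym; under eq_bigr do rewrite mulr_sumr.
rewrite (exchange_big_dep Q) /=; last by move=> x y _ /andP[].
apply: eq_bigr => y Qy; rewrite mulr_sumr.
by apply: eq_big => [x|x _]; rewrite ?Qy ?(esym x) // mulrC.
Qed.

Definition near_regular (R : realFieldType) (T : finType) (e : rel T) (l : T -> R)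
    (r eps : R) : Prop :=
  [/\ forall x, 0 <= l x, 1 - eps <= \sum_x l x <= 1 &
      forall x, r - eps <= \sum_(y | e x y) l y <= r + eps].

Section NearRegular.

Variables (R : realFieldType) (T : finType) (e : rel T) (l : T -> R) (r eps : R).
Hypothesis reg : near_regular e l r eps.

Lemma near_regular_eps_ge0 : 0 <= eps.
Proof. by case: reg => _ /andP[? ?] _; lra. Qed.

Lemma near_regular_card_gt0 : eps < 1 -> (0 < #|T|)%N.
Proof.
move=> eps1; rewrite lt0n; apply/negP => /eqP/card0_eq noT.
by case: reg => _ /andP[]; rewrite big_pred0 // => ? _ _; lra.
Qed.

Lemma near_regular_nbr (x : T) : eps < r -> exists y, e x y.
Proof.
move=> eps_r; apply/existsP; rewrite -[[exists _, _]]negbK negb_exists.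
apply/negP => /forallP no_nbr; case: reg => _ _ /(_ x) /andP[].
by rewrite big_pred0 => [|y]; [lra | apply/negbTE].
Qed.

(* Weak duality: the sum of [y i * l j] over the adjacent pairs is computed in two ways. *)
Lemma near_regular_dual (y : T -> R) (C A : R) : symmetric e ->
  (forall i, `|y i| <= C) -> (forall i, \sum_(j | e i j) y j <= A) ->
  r * (\sum_i y i) - #|T|%:R * (C * eps) <= A * (\sum_i l i).
Proof.
move=> esym yC yA; case: reg => l_ge0 _ deg.
apply: le_trans (_ : \sum_i y i * (\sum_(j | e i j) l j) <= _).
  rewrite -[#|T|]/(#|xpredT|) mulr_natl -sumr_const mulr_sumr -sumrB.
  apply: ler_sum => i _; move: (deg i) (yC i); rewrite ler_norml.
  move: (\sum_(j | _) _) (y i) => d yi /andP[d_lo d_hi] /andP[y_lo y_hi].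
  have := mulr_ge0 (_ : 0 <= C + yi) (_ : 0 <= d - r + eps).
  have := mulr_ge0 (_ : 0 <= C - yi) (_ : 0 <= eps + r - d).
  by move=> /(_ ltac:(lra) ltac:(lra)) ? /(_ ltac:(lra) ltac:(lra)) ?; lra.
rewrite (exchange_sum_adj xpredT xpredT) //= mulr_sumr.
by apply: ler_sum => j _; rewrite mulrC; apply: ler_wpM2r.
Qed.

End NearRegular.

(** * Dual certificates for the extensions of the pentagon *)

(* A certificate [(z, a, b)] stands for the multipliers [y i = z i - 2], with
   [\sum_i y i = 3 a - 8 b] and [(M y) i <= a - 3 b] for all [i]. *)
Definition certificate : Type := seq nat * nat * nat.

Definition proper_certificate (crt : certificate) : bool :=
  let: (z, a, b) := crt in
  [&& size z == 8, all (fun k => k <= 4)%N z, (0 < a + b)%N &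
      (sumn z + 8 * b == 3 * a + 16)%N].

(* [has] and [all] evaluate the whole list by call-by-value reduction, whereas [find]
   stops at the first hit. *)
Definition certifies (M : seq bitseq) (crt : certificate) : bool :=
  let: (z, a, b) := crt in
  (find (fun row => a + 2 * count id row < sumn (mask row z) + 3 * b) M == size M)%N.

Lemma certifiesE (M : seq bitseq) (z : seq nat) (a b : nat) :
  certifies M (z, a, b) =
  all (fun row => sumn (mask row z) + 3 * b <= a + 2 * count id row)%N M.
Proof.
rewrite /certifies eqn_leq find_size leqNgt -has_find -all_predC.
by apply: eq_all => row; rewrite /= -leqNgt.
Qed.

Lemma sumn_mask (m : bitseq) (z : seq nat) :
  sumn (mask m z) = (\sum_(i < size z | nth false m i) nth 0 z i)%N.
Proof.
rewrite sumnE big_mask; apply: eq_big => [i|i _]; first by rewrite andbT.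
by rewrite (tnth_nth 0%N).
Qed.

Definition rel_matrix (M : rel nat) : seq bitseq := mkseq (fun i => mkseq (M i) 8) 8.

Section Certificate.

Variables (R : realFieldType) (M : rel nat) (z : seq nat) (a b : nat).

Definition multiplier (i : nat) : R := (nth 0%N z i)%:R - 2.

Lemma multiplier_norm (i : nat) : proper_certificate (z, a, b) -> `|multiplier i| <= 2.
Proof.
case/and4P => _ /allP z4 _ _.
have : (nth 0 z i <= 4)%N.
  by case: (ltnP i (size z)) => iz; [apply/z4/mem_nth | rewrite nth_default].
rewrite -(ler_nat R) ler_norml /multiplier; have := ler0n R (nth 0 z i); lra.
Qed.

Lemma sum_multiplier : proper_certificate (z, a, b) ->
  \sum_(i < 8) multiplier i = 3 * a%:R - 8 * b%:R.
Proof.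
case/and4P => /eqP z8 _ _ /eqP /(congr1 (fun k => k%:R : R)).
rewrite sumnE (big_nth 0%N) z8 big_mkord !natrD ?natrM natr_sum.
rewrite /multiplier sumrB sumr_const card_ord -[_ *+ 8]mulr_natl.
by move: (\sum_i _) => t; lra.
Qed.

Lemma row_multiplier (i : nat) : proper_certificate (z, a, b) ->
  certifies (rel_matrix M) (z, a, b) -> (i < 8)%N ->
  \sum_(j < 8 | M i j) multiplier j <= a%:R - 3 * b%:R.
Proof.
case/and4P => /eqP z8 _ _ _; rewrite certifiesE => /allP cert i8.
have /cert : mkseq (M i) 8 \in rel_matrix M by apply/mapP; exists i; rewrite ?mem_iota.
rewrite sumn_mask -sum1_count (big_nth false) size_mkseq z8 big_mkord.
have rowE (j : 'I_8) : nth false (mkseq (M i) 8) j = M i j by rewrite nth_mkseq.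
rewrite !(eq_bigl _ _ rowE) -(ler_nat R) !natrD ?natrM !natr_sum /multiplier sumrB.
under [X in _ -> _ - X <= _]eq_bigr do rewrite -[2]mulr1.
by rewrite -mulr_sumr /=; move: (\sum_(j | _) _) (\sum_(j | _) _) => p q; lra.
Qed.

Lemma certified_error_gt (w : 'I_8 -> R) (r eps : R) : symmetric M ->
  proper_certificate (z, a, b) -> certifies (rel_matrix M) (z, a, b) ->
  near_regular (fun i j : 'I_8 => M i j) w r eps ->
  4 / 11 <= r < 3 / 8 -> 3 / 8 - r < 6 * eps.
Proof.
move=> Msym proper cert reg /andP[r_lo r_hi]; rewrite ltNge; apply/negP => eps_le.
have eps_ge0 := near_regular_eps_ge0 reg.
have := near_regular_dual reg (fun i j => Msym i j)
  (fun i => multiplier_norm i proper) (fun i => row_multiplier proper cert (ltn_ord i)).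
rewrite sum_multiplier // card_ord; case: (reg) => _ /andP[].
move: (\sum_i w i) => W W_lo W_hi _ duality.
have {duality} : a%:R * (3 * r - W) + b%:R * (3 * W - 8 * r) <= 16 * eps by lra.
have : 1 / 11 * a%:R <= a%:R * (3 * r - W) by rewrite mulrC ler_wpM2l //; lra.
have : 45 / 6 * (3 / 8 - r) * b%:R <= b%:R * (3 * W - 8 * r).
  by rewrite [_ * b%:R]mulrC ler_wpM2l //; lra.
case: (posnP a) proper => [-> /and4P[_ _ b_gt0 _]|a_gt0 _].
  have : (3 / 8 - r) * 1 <= (3 / 8 - r) * b%:R by rewrite ler_wpM2l ?ler1n //; lra.
  lra.
have : 1 <= a%:R :> R by rewrite ler1n.
have : 0 <= (3 / 8 - r) * b%:R by rewrite mulr_ge0 //; lra.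
lra.
Qed.

End Certificate.

(* The certificates come in orbits under the symmetries of the pentagon and the permutations
   of the other three vertices. *)
Definition pentagon_certificates : seq certificate :=
  flatten [seq let: (p, q, a, b) := crt in
    [seq (p' ++ q', a, b) |
       p' <- [seq rot i p | i <- iota 0 5] ++ [seq rot i (rev p) | i <- iota 0 5],
       q' <- permutations q]
    | crt <-
      [:: ([:: 2; 3; 3; 3; 3], [:: 2; 3; 3], 2, 0);
          ([:: 1; 1; 1; 2; 2], [:: 2; 2; 3], 2, 1);
          ([:: 1; 1; 1; 1; 3], [:: 0; 2; 2], 1, 1);
          ([:: 1; 1; 2; 3; 2], [:: 2; 3; 3], 3, 1);
          ([:: 1; 1; 2; 2; 3], [:: 0; 2; 3], 2, 1);
          ([:: 1; 2; 1; 2; 2], [:: 1; 2; 3], 2, 1);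
          ([:: 1; 1; 1; 1; 1], [:: 2; 2; 2], 1, 1);
          ([:: 1; 1; 1; 2; 3], [:: 1; 2; 3], 2, 1);
          ([:: 2; 2; 3; 3; 3], [:: 3; 3; 3], 2, 0);
          ([:: 0; 1; 1; 2; 2], [:: 2; 3; 3], 2, 1);
          ([:: 1; 1; 1; 1; 2], [:: 2; 3; 3], 2, 1);
          ([:: 1; 1; 1; 1; 1], [:: 1; 1; 1], 0, 1)]%N].

Fixpoint bitseqs (n : nat) : seq bitseq :=
  if n is m.+1 then [seq b :: s | b <- [:: true; false], s <- bitseqs m] else [:: [::]].

Lemma mem_bitseqs (s : bitseq) : s \in bitseqs (size s).
Proof.
elim: s => // b s IH; rewrite /= cats0 mem_cat.
by case: b; rewrite map_f ?orbT.
Qed.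

(* The pattern of a vertex lists its adjacencies to the vertices of the pentagon. *)
Definition pentagon_patterns : seq bitseq :=
  [seq p <- bitseqs 5 |
   all (fun i => ~~ (nth false p i && nth false p (i.+1 %% 5)%N)) (iota 0 5)].

Definition rooted_patterns : seq bitseq :=
  [seq [:: a; false; b; false; false] | a <- [:: true; false], b <- [:: true; false]].

Definition disjoint_patterns (p q : bitseq) : bool :=
  all (fun i => ~~ (nth false p i && nth false q i)) (iota 0 5).

Definition compatible_patterns (p q t : bitseq) (f g h : bool) : bool :=
  [&& f ==> disjoint_patterns p q, g ==> disjoint_patterns p t,
      h ==> disjoint_patterns q t & ~~ [&& f, g & h]].

Definition pentagon_matrix (p q t : bitseq) (f g h : bool) : seq bitseq :=
  [seq [seq (j == i.+1 %% 5) || (i == j.+1 %% 5) | j <- iota 0 5]%N ++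
       [:: nth false p i; nth false q i; nth false t i] | i <- iota 0 5] ++
  [:: p ++ [:: false; f; g]; q ++ [:: f; false; h]; t ++ [:: g; h; false]].

Definition certified_extensions (certs : seq certificate) : bool :=
  let bools := [:: true; false] in
  all (fun p => all (fun q => all (fun t => all (fun f => all (fun g => all (fun h =>
    if compatible_patterns p q t f g h
    then find (certifies (pentagon_matrix p q t f g h)) certs < size certs else true)%N
  bools) bools) bools) pentagon_patterns) pentagon_patterns) rooted_patterns.

Lemma pentagon_certificates_proper : all proper_certificate pentagon_certificates.
Proof. by vm_compute. Qed.

Lemma pentagon_certificates_extensions : certified_extensions pentagon_certificates.
Proof. by vm_compute. Qed.

Lemma pentagon_pattern_rooted (p : bitseq) :
  p \in pentagon_patterns -> exists k, rot k p \in rooted_patterns.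
Proof.
have /allP rooted : all (fun q => has (fun k => rot k q \in rooted_patterns) (iota 0 5))
  pentagon_patterns by vm_compute.
by move=> /rooted/hasP[k _ kP]; exists k.
Qed.

Lemma pentagon_matrix_certificate (p q t : bitseq) (f g h : bool) :
  p \in rooted_patterns -> q \in pentagon_patterns -> t \in pentagon_patterns ->
  compatible_patterns p q t f g h ->
  exists2 crt, proper_certificate crt & certifies (pentagon_matrix p q t f g h) crt.
Proof.
move=> pP qP tP ok; have /allP proper := pentagon_certificates_proper.
have mem_bool (b : bool) : b \in [:: true; false] by case: b.
have := pentagon_certificates_extensions.
move=> /allP/(_ _ pP)/allP/(_ _ qP)/allP/(_ _ tP)/allP/(_ _ (mem_bool f)).
move=> /allP/(_ _ (mem_bool g))/allP/(_ _ (mem_bool h)); rewrite ok -has_find.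
by move=> /hasP[crt /proper]; exists crt.
Qed.

Section Pentagon.

Variables (T : eqType) (e : rel T) (c : seq T).
Hypotheses (esym : symmetric e) (etf : triangle_free_rel e).
Hypotheses (c_cycle : cycle e c) (c5 : size c = 5%N).

Lemma pentagon_uniq : uniq c.
Proof.
have irr := triangle_free_irr etf.
have neq x y : e x y -> x != y by apply: contraTneq => ->; rewrite irr.
have neq2 x y z w : e x y -> e y z -> e z w -> x != w.
  move=> xy yz; apply: contraTneq => <-; rewrite esym; exact: etf xy yz.
move: c_cycle c5; case: (c) => [|c0 [|c1 [|c2 [|c3 [|c4 []]]]]] //=.
move=> /and5P[e01 e12 e23 e34 /andP[e40 _]] _; rewrite !inE !negb_or.
rewrite !(neq _ _ e01, neq _ _ e12, neq _ _ e23, neq _ _ e34).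
rewrite [c0 == c4]eq_sym (neq _ _ e40) [c0 == c2]eq_sym (neq2 _ _ _ _ e23 e34 e40).
rewrite [c1 == c3]eq_sym (neq2 _ _ _ _ e34 e40 e01) [c2 == c4]eq_sym.
by rewrite (neq2 _ _ _ _ e40 e01 e12) (neq2 _ _ _ _ e12 e23 e34) (neq2 _ _ _ _ e01 e12 e23).
Qed.

Lemma mem_pentagon_patterns (z : T) : map (e z) c \in pentagon_patterns.
Proof.
have not_both x y : e x y -> ~~ (e z x && e z y).
  by move=> xy; apply/negP => /andP[zx]; apply/negP; apply: etf xy.
have := mem_bitseqs (map (e z) c); rewrite mem_filter size_map c5 => ->; rewrite andbT.
move: c_cycle c5; case: (c) => [|c0 [|c1 [|c2 [|c3 [|c4 []]]]]] //=.
by move=> /and5P[e01 e12 e23 e34 /andP[e40 _]] _; rewrite !not_both.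
Qed.

Lemma disjoint_patterns_adj (z a : T) :
  e z a ==> disjoint_patterns (map (e z) c) (map (e a) c).
Proof.
apply/implyP => za; apply/allP => i; rewrite mem_iota => /andP[_ i5].
case: c c5 i5 => // d s c5' i5; rewrite !(nth_map d) ?c5' //.
by apply/negP => /andP[zx]; apply/negP; apply: contraL zx; apply: etf.
Qed.

Lemma compatible_patterns_adj (z a b : T) :
  compatible_patterns (map (e z) c) (map (e a) c) (map (e b) c) (e z a) (e z b) (e a b).
Proof.
rewrite /compatible_patterns !disjoint_patterns_adj /=.
by apply/negP => /and3P[za zb ab]; have := etf za ab; rewrite zb.
Qed.

Lemma pentagon_matrixE (d z a b : T) :
  rel_matrix (relpre (nth d (c ++ [:: z; a; b])) e) =
  pentagon_matrix (map (e z) c) (map (e a) c) (map (e b) c) (e z a) (e z b) (e a b).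
Proof.
move: c_cycle c5; case: (c) => [|c0 [|c1 [|c2 [|c3 [|c4 []]]]]] //=.
move=> /and5P[e01 e12 e23 e34 /andP[e40 _]] _.
have adj x y : e x y -> (e x y = true) * (e y x = true) by rewrite [e y x]esym => ->.
have path2 x y z' : e x y -> e y z' -> (e x z' = false) * (e z' x = false).
  by move=> xy yz; rewrite [e z' x]esym (negbTE (etf xy yz)).
rewrite /rel_matrix /mkseq /= /pentagon_matrix /= !(triangle_free_irr etf).
rewrite !(adj _ _ e01) !(adj _ _ e12) !(adj _ _ e23) !(adj _ _ e34) !(adj _ _ e40).
rewrite !(path2 _ _ _ e01 e12) !(path2 _ _ _ e12 e23) !(path2 _ _ _ e23 e34).
rewrite !(path2 _ _ _ e34 e40) !(path2 _ _ _ e40 e01).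
by rewrite !(esym _ z) !(esym _ a) !(esym _ b).
Qed.

End Pentagon.

(** * Near-regular weightings of graphs on at most eight vertices *)

Section Bipartition.

Variables (T : finType) (e : rel T).

Definition bipartition (P : {set T}) : Prop := forall x y, e x y -> (x \in P) = (y \notin P).

Definition have_common_nbr (x y : T) : bool := [exists w, e x w && e y w].

Lemma have_common_nbrP (x y : T) : reflect (exists2 w, e x w & e y w) (have_common_nbr x y).
Proof. exact: exists_inP. Qed.

Lemma bipartitionC (P : {set T}) : bipartition P -> bipartition (~: P).
Proof. by move=> bip x y /bip xy; rewrite !inE xy. Qed.

Lemma bipartite_of_common_nbrs (x0 y0 : T) :
  symmetric e -> triangle_free_rel e -> (forall c, size c = 5%N -> ~~ cycle e c) ->
  (forall x y z, [|| have_common_nbr x y, have_common_nbr x z | have_common_nbr y z]) ->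
  e x0 y0 -> exists P, bipartition P.
Proof.
move=> esym etf no_c5 share3 e0.
have edge_no_share x y : e x y -> have_common_nbr x y = false.
  move=> xy; apply/negbTE/negP => /have_common_nbrP[w xw yw].
  by have := etf _ _ _ xy yw; rewrite xw.
have share_xor z : have_common_nbr z y0 = ~~ have_common_nbr z x0.
  have := share3 z x0 y0; rewrite (edge_no_share _ _ e0) orbF.
  case: (boolP (have_common_nbr z x0)) => [/have_common_nbrP[a za xa] _|_ /= ->] //.
  apply/negbTE/negP => /have_common_nbrP[b zb yb].
  have /negP[] := no_c5 [:: z; a; x0; y0; b] erefl.
  by rewrite /= za esym xa e0 yb esym zb.
exists [set z | have_common_nbr z x0] => x y xy; rewrite !inE.
have := share3 x y x0; have := share3 x y y0; rewrite !(edge_no_share _ _ xy) !share_xor /=.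
by case: (have_common_nbr x x0); case: (have_common_nbr y x0).
Qed.

End Bipartition.

Section SmallNearRegular.

Variables (R : realFieldType) (T : finType) (e : rel T) (l : T -> R) (r eps : R).
Hypotheses (esym : symmetric e) (etf : triangle_free_rel e).
Hypothesis reg : near_regular e l r eps.
Hypothesis r_range : 4 / 11 <= r < 3 / 8.

Lemma near_regular_enum (d : T) (s : seq T) (n : nat) :
  uniq s -> (forall x, x \in s) -> (size s <= n)%N ->
  near_regular (fun i j : 'I_n => e (nth d s i) (nth d s j))
    (fun j => if (j < size s)%N then l (nth d s j) else 0) r eps.
Proof.
move=> us sT sn.
have sumE (F : T -> R) : \sum_(j < n) (if (j < size s)%N then F (nth d s j) else 0) = \sum_x F x.
  rewrite [RHS](perm_big s) /=; last first.
    by apply: uniq_perm; rewrite ?index_enum_uniq // => x; rewrite mem_index_enum sT.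
  by rewrite (big_nth d) big_mkord (big_ord_widen n (fun j => F (nth d s j))) // [RHS]big_mkcond.
case: reg => l_ge0 total deg; split=> [j||i]; first by case: ifP.
  by rewrite sumE.
have := deg (nth d s i); rewrite [in X in X -> _]big_mkcond -sumE.
by rewrite [in X in _ -> X]big_mkcond (eq_bigr (fun j : 'I_n => if e (nth d s i) (nth d s j)
  then if (j < size s)%N then l (nth d s j) else 0 else 0)) // => j _; case: ifP; case: ifP.
Qed.

Lemma pentagon_error_gt (c : seq T) : (#|T| <= 8)%N -> cycle e c -> size c = 5%N ->
  3 / 8 - r < 6 * eps.
Proof.
move=> T8 c_cycle c5; have [d _] : exists d : T, true by case: (c) c5 => // d; exists d.
pose rest := [seq x <- enum T | x \notin c]; pose v := nth d rest.
have [k rooted] := pentagon_pattern_rooted (mem_pentagon_patterns etf c_cycle c5 (v 0%N)).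
pose c' := rot k c; pose s := c' ++ rest.
have c'_cycle : cycle e c' by rewrite rot_cycle.
have c'5 : size c' = 5%N by rewrite size_rot.
have mem_s x : x \in s by rewrite mem_cat mem_rot mem_filter mem_enum andbT orbN.
have uniq_s : uniq s.
  rewrite cat_uniq rot_uniq (pentagon_uniq esym etf c_cycle c5) filter_uniq ?enum_uniq //.
  by rewrite andbT; apply/hasPn => x; rewrite mem_rot mem_filter => /andP[].
have size_s : (size s <= 8)%N.
  by apply: leq_trans T8; rewrite -(card_uniqP uniq_s) max_card.
rewrite -map_rot in rooted.
have pattern w := mem_pentagon_patterns etf c'_cycle c'5 w.
have [[[z a] b] proper cert] := pentagon_matrix_certificate rooted (pattern (v 1%N))
  (pattern (v 2%N)) (compatible_patterns_adj etf c'5 _ _ _).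
apply: (certified_error_gt (M := relpre (nth d s) e) _ proper _ _ r_range).
- by move=> i j /=.
- suff -> : rel_matrix (relpre (nth d s) e) =
      rel_matrix (relpre (nth d (c' ++ [:: v 0%N; v 1%N; v 2%N])) e).
    by rewrite (pentagon_matrixE esym etf c'_cycle c'5).
  have nthE i : nth d s i = nth d (c' ++ [:: v 0; v 1; v 2])%N i.
    have nth_pad3 (q : seq T) j : (size q <= 3)%N ->
        nth d q j = nth d [:: nth d q 0; nth d q 1; nth d q 2]%N j.
      by case: q j => [|? [|? [|? []]]] // [|[|[|j]]] //= _; rewrite nth_nil.
    by rewrite !nth_cat c'5; case: ifP => // _; apply: nth_pad3; move: size_s; rewrite size_cat c'5.
  by apply: eq_mkseq => i; apply: eq_mkseq => j; rewrite /= !nthE.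
exact: near_regular_enum.
Qed.

Hypothesis eps_small : 6 * eps <= 3 / 8 - r.

Lemma near_regular_common_nbr (x y z : T) :
  [|| have_common_nbr e x y, have_common_nbr e x z | have_common_nbr e y z].
Proof.
apply/negPn/negP; rewrite !negb_or => /and3P[].
move=> /existsPn nxy /existsPn nxz /existsPn nyz.
case: reg => l_ge0 /andP[_ total] deg.
have : \sum_(w | e x w) l w + \sum_(w | e y w) l w + \sum_(w | e z w) l w <= \sum_w l w.
  rewrite ![\sum_(w | e _ w) _]big_mkcond -!big_split /=; apply: ler_sum => w _.
  move: (nxy w) (nxz w) (nyz w) (l_ge0 w).
  by case: (e x w); case: (e y w); case: (e z w) => //= _ _ _; lra.
move: (deg x) (deg y) (deg z) total eps_small.
move: (\sum_(w | e x w) _) (\sum_(w | e y w) _) (\sum_(w | e z w) _) (\sum_w _) => dx dy dz t.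
move: r_range => /andP[r_lo _] /andP[dx_lo _] /andP[dy_lo _] /andP[dz_lo _].
lra.
Qed.

Lemma bipartite_class_le (Q : {set T}) : bipartition e Q -> \sum_(x in Q) l x <= 1 / 2 + 2 * eps.
Proof.
move=> bipQ; case: reg => l_ge0 /andP[_ total] deg.
have eps_ge0 := near_regular_eps_ge0 reg; case/andP: r_range => r_lo r_hi.
set p := \sum_(x in Q) l x; pose q := \sum_(y | y \notin Q) l y.
have balance : p * (r - eps) <= q * (r + eps).
  apply: (@le_trans _ R (\sum_(x in Q) l x * (\sum_(y | (y \notin Q) && e x y) l y))).
    rewrite /p mulr_suml; apply: ler_sum => x xQ; apply: ler_wpM2l => //.
    have /andP[+ _] := deg x; congr (_ <= _); apply: eq_bigl => y.
    by case xy: (e x y); rewrite ?andbF // -(bipQ _ _ xy) xQ.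
  rewrite exchange_sum_adj // /q mulr_suml; apply: ler_sum => y _; apply: ler_wpM2l => //.
  by have /andP[_] := deg y; apply: le_trans; apply: ler_psum_sub => // x /andP[].
have {}total : p + q <= 1 by apply: le_trans total; rewrite [leRHS](bigID (mem Q)).
have : q * (r + eps) <= (1 - p) * (r + eps) by rewrite ler_wpM2r //; lra.
have : eps * (4 / 11) <= eps * r by rewrite ler_wpM2l.
rewrite leNgt => eps_r q_le; apply/negP => p_gt.
have : (1 / 2 + 2 * eps) * r < p * r by rewrite ltr_pM2r //; lra.
lra.
Qed.

Lemma bipartite_class_ge (Q : {set T}) : bipartition e Q -> 1 / 2 - 3 * eps <= \sum_(x in Q) l x.
Proof.
move=> bipQ; have := bipartite_class_le (bipartitionC bipQ).
have -> : \sum_(x in ~: Q) l x = \sum_x l x - \sum_(x in Q) l x.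
  by rewrite [\sum_x _](bigID (mem Q)) addrC addKr; apply: eq_bigl => x; rewrite inE.
by case: reg => _ /andP[+ _] _; lra.
Qed.

Section Class.

Variable P : {set T}.
Hypothesis bip : bipartition e P.

Definition missed_weight (y : T) : R := \sum_(x in P | ~~ e y x) l x.

Lemma missed_weight_bounds (y : T) : y \notin P ->
  1 / 2 - r - 4 * eps <= missed_weight y <= 1 / 2 - r + 3 * eps.
Proof.
move=> yP; have : \sum_(x in P) l x = missed_weight y + \sum_(x | e y x) l x.
  rewrite (bigID (e y)) /= addrC; congr (_ + _); apply: eq_bigl => x.
  by case yx: (e y x); rewrite ?andbF // andbT -[x \in P]negbK -(bip yx) yP.
have := bipartite_class_le bip; have := bipartite_class_ge bip; case: reg => _ _ /(_ y)/andP[].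
by move: (\sum_(x in P) _) (\sum_(x | _) _) => p d; lra.
Qed.

Lemma exists_missing (x : T) : x \in P -> exists2 y, y \notin P & ~~ e y x.
Proof.
move=> xP; apply/exists_inP; apply: contraT => /exists_inPn hit; exfalso.
have : \sum_(y in ~: P) l y <= \sum_(y | e x y) l y.
  case: reg => l_ge0 _ _; apply: ler_psum_sub => // y; rewrite inE => /hit.
  by rewrite negbK esym.
have := bipartite_class_ge (bipartitionC bip); case: reg => _ _ /(_ x)/andP[_].
by case/andP: r_range eps_small; move: (\sum_(y | e x y) _) => d; lra.
Qed.

Lemma missed_cover_gt3 (Q : {set T}) : Q \subset ~: P ->
  (forall x, x \in P -> exists2 y, y \in Q & ~~ e y x) -> (3 < #|Q|)%N.
Proof.
move=> /subsetP QP cover; rewrite ltnNge; apply/negP => Q3; case: reg => l_ge0 _ _.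
have : \sum_(x in P) l x <= \sum_(y in Q) missed_weight y.
  rewrite /missed_weight (exchange_big_dep (mem P)) /=; last by move=> y x _ /andP[].
  apply: ler_sum => x xP; have [y yQ yx] := cover x xP.
  by rewrite (bigD1 y) /= ?yQ ?xP // lerDl sumr_ge0.
have : \sum_(y in Q) missed_weight y <= \sum_(y in Q) (1 / 2 - r + 3 * eps).
  by apply: ler_sum => y /QP; rewrite inE => /missed_weight_bounds/andP[].
rewrite sumr_const -[_ *+ _]mulr_natl; case/andP: r_range => r_lo r_hi.
have eps_ge0 := near_regular_eps_ge0 reg; have eps_le := eps_small.
have : #|Q|%:R * (1 / 2 - r + 3 * eps) <= 3 * (1 / 2 - r + 3 * eps).
  by rewrite ler_wpM2r ?ler_nat //; lra.
have := bipartite_class_ge bip; move: (\sum_(x in P) _) (\sum_(y in Q) _) (#|Q|%:R * _).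
by move=> p t u; lra.
Qed.

(* A smallest cover of [P] by missed sets needs four of them. If [P] had only four
   vertices, each would miss a single vertex, and their weights would exceed that of [P]. *)
Lemma bipartite_class_gt4 : (4 < #|P|)%N.
Proof.
rewrite ltnNge; apply/negP => P4; case/andP: r_range => r_lo r_hi; have eps_le := eps_small.
have misses x : exists y, (x \in P) ==> (y \notin P) && ~~ e y x.
  case: (boolP (x \in P)) => [/exists_missing[y yP yx]|_]; last by exists x.
  by exists y; rewrite yP.
pose f x := xchoose (misses x).
have fP x : x \in P -> f x \notin P.
  by move=> xP; have /implyP/(_ xP)/andP[] := xchooseP (misses x).
have f_miss x : x \in P -> ~~ e (f x) x.
  by move=> xP; have /implyP/(_ xP)/andP[] := xchooseP (misses x).
have cover_gt3 (Q : {set T}) : Q \subset P ->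
    (forall x, x \in P -> exists2 y, y \in Q & ~~ e (f y) x) -> (3 < #|Q|)%N.
  move=> /subsetP QP cover; apply: leq_trans (leq_imset_card f Q); apply: missed_cover_gt3.
    by apply/subsetP => _ /imsetP[x /QP/fP fx ->]; rewrite inE.
  by move=> x /cover[y yQ yx]; exists (f y) => //; apply: imset_f.
have {P4} P4 : #|P| = 4%N.
  by apply/eqP; rewrite eqn_leq P4 cover_gt3 // => x xP; exists x => //; apply: f_miss.
have f_hits x y : x \in P -> y \in P -> y != x -> e (f x) y.
  move=> xP yP yx; apply/negPn/negP => fxy.
  have P3 : #|P :\ y| = 3%N by move: P4; rewrite (cardsD1 y P) yP => -[].
  suff : (3 < #|P :\ y|)%N by rewrite P3.
  apply: cover_gt3 (subD1set _ _) _ => z zP.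
  have [->|zy] := eqVneq z y; first by exists x => //; rewrite !inE eq_sym yx.
  by exists z; [rewrite !inE zy | apply: f_miss].
have missed_f x : x \in P -> missed_weight (f x) = l x.
  move=> xP; rewrite /missed_weight (bigD1 x) ?xP ?f_miss //= big1 ?addr0 //.
  by move=> y /andP[/andP[yP fxy] yx]; rewrite f_hits in fxy.
have : \sum_(x in P) (1 / 2 - r - 4 * eps) <= \sum_(x in P) l x.
  by apply: ler_sum => x xP; rewrite -missed_f //; have /andP[] := missed_weight_bounds (fP x xP).
rewrite sumr_const P4 -[_ *+ 4]mulr_natl; have := bipartite_class_le bip.
by move: (\sum_(x in P) _) => p; lra.
Qed.

End Class.

End SmallNearRegular.

Lemma small_near_regular_error_gt (R : realFieldType) (T : finType) (e : rel T) (l : T -> R)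
    (r eps : R) :
  (#|T| <= 8)%N -> symmetric e -> triangle_free_rel e -> near_regular e l r eps ->
  4 / 11 <= r < 3 / 8 -> 3 / 8 - r < 6 * eps.
Proof.
move=> T8 esym etf reg r_range; rewrite ltNge; apply/negP => eps_small.
case/andP: (r_range) => r_lo r_hi.
have /card_gt0P[x0 _] : (0 < #|T|)%N by apply: (near_regular_card_gt0 reg); lra.
have [y0 e0] : exists y0, e x0 y0 by apply: (near_regular_nbr reg); lra.
have no_c5 c : size c = 5%N -> ~~ cycle e c.
  move=> c5; apply/negP => c_cycle.
  by have := pentagon_error_gt esym etf reg r_range T8 c_cycle c5; lra.
have [P bip] := bipartite_of_common_nbrs esym etf no_c5
  (near_regular_common_nbr reg r_range eps_small) e0.
have := bipartite_class_gt4 esym reg r_range eps_small bip.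
have := bipartite_class_gt4 esym reg r_range eps_small (bipartitionC bip).
by have := cardsC P; lia.
Qed.

(** * From near-regular measures to small graphs *)

Section SeparatedSets.

Variables (R : realDomainType) (T : finType) (d : T -> T -> R) (th : R).

Definition separated (S : {set T}) : bool :=
  [forall x in S, forall y in S, (x != y) ==> (th <= d x y)].

Lemma separatedP (S : {set T}) :
  reflect {in S &, forall x y, x != y -> th <= d x y} (separated S).
Proof.
apply: (iffP forall_inP) => [sepS x y /sepS/forall_inP sepx yS|sepS x xS].
  exact: (implyP (sepx y yS)).
by apply/forall_inP => y yS; apply/implyP; apply: sepS.
Qed.

Lemma maximal_separated : 0 < th -> (forall x, d x x = 0) -> (forall x y, d x y = d y x) ->
  exists2 S, separated S & forall x, exists2 i, i \in S & d x i < th.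
Proof.
move=> th_gt0 dxx dC; have [S maxS] : {S | maxset separated S}.
  by apply: ex_maxset; exists set0; apply/separatedP => x y; rewrite inE.
have [/separatedP sepS _] := maxsetP maxS; exists S => [|x]; first exact/separatedP.
apply/exists_inP; apply: contraT => /exists_inPn far; exfalso.
have xS : x \notin S by apply/negP => /far; rewrite dxx th_gt0.
suff /(maxsetsup maxS)/(_ (subsetUr _ _)) SE : separated (x |: S).
  by move: xS; rewrite -SE setU11.
apply/separatedP => a b /setU1P[->|aS] /setU1P[->|bS]; rewrite ?eqxx //.
- by move=> _; rewrite leNgt far.
- by move=> _; rewrite dC leNgt far.
exact: sepS.
Qed.

End SeparatedSets.

Section NeighborhoodDistance.

Variables (R : realFieldType) (T : finType) (e : rel T) (l : T -> R).

Definition nbhd_dist (x y : T) : R := \sum_(z | e x z != e y z) l z.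

Lemma nbhd_distxx (x : T) : nbhd_dist x x = 0.
Proof. by rewrite /nbhd_dist big_pred0 // => z; rewrite eqxx. Qed.

Lemma nbhd_distC (x y : T) : nbhd_dist x y = nbhd_dist y x.
Proof. by apply: eq_bigl => z; rewrite eq_sym. Qed.

Lemma nbhd_dist_sub (Z : pred T) (x y : T) : (forall z, 0 <= l z) ->
  \sum_(z | Z z && e x z) l z <= \sum_(z | Z z && e y z) l z + nbhd_dist x y.
Proof.
move=> l_ge0; rewrite /nbhd_dist [leLHS]big_mkcond [X in _ <= X + _]big_mkcond.
rewrite [X in _ <= _ + X]big_mkcond -big_split /=; apply: ler_sum => z _.
by have := l_ge0 z; case: (Z z); case: (e x z); case: (e y z) => //=; lra.
Qed.

End NeighborhoodDistance.

Section Clusters.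

Variables (R : realFieldType) (T : finType) (e : rel T) (l : T -> R) (th : R).
Variables (S : {set T}) (rep : T -> T).
Hypotheses (esym : symmetric e) (etf : triangle_free_rel e) (l_ge0 : forall x, 0 <= l x).
Hypotheses (th_gt0 : 0 < th) (rep_in : forall x, rep x \in S).
Hypothesis rep_close : forall x, nbhd_dist e l x (rep x) < th.

Definition cweight (i : T) : R := \sum_(x | rep x == i) l x.

Definition cdegree (x j : T) : R := \sum_(y | (rep y == j) && e x y) l y.

Definition cedges (i j : T) : R := \sum_(x | rep x == i) l x * cdegree x j.

Lemma cweight_ge0 (i : T) : 0 <= cweight i.
Proof. exact: sumr_ge0. Qed.

Lemma sum_partition (P : pred T) :
  \sum_(x | P x) l x = \sum_(i in S) \sum_(x | (rep x == i) && P x) l x.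
Proof.
rewrite (partition_big rep (mem S)) //=.
by apply: eq_bigr => i _; apply: eq_bigl => x; rewrite andbC.
Qed.

Lemma cdegree_ge0 (x j : T) : 0 <= cdegree x j.
Proof. exact: sumr_ge0. Qed.

Lemma cdegree_compl (x j : T) :
  \sum_(y | (rep y == j) && ~~ e x y) l y = cweight j - cdegree x j.
Proof. by rewrite [cweight j](bigID (e x)) /= -/(cdegree x j) addrAC subrr add0r. Qed.

Lemma cdegree_le (x j : T) : cdegree x j <= cweight j.
Proof. by rewrite -subr_ge0 -cdegree_compl; apply: sumr_ge0. Qed.

Lemma cdegree_close (x j : T) :
  cdegree (rep x) j - th <= cdegree x j <= cdegree (rep x) j + th.
Proof.
have := nbhd_dist_sub e (fun z => rep z == j) x (rep x) l_ge0.
have := nbhd_dist_sub e (fun z => rep z == j) (rep x) x l_ge0.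
rewrite nbhd_distC -/(cdegree _ _) -/(cdegree _ _); have := rep_close x => dist_lt x_le rep_le.
by apply/andP; split; lra.
Qed.

Lemma cedgesC (i j : T) : cedges i j = cedges j i.
Proof. exact: exchange_sum_adj. Qed.

Lemma cedges_bounds (i j : T) :
  cweight i * (cdegree i j - th) <= cedges i j <= cweight i * (cdegree i j + th).
Proof.
rewrite /cweight !mulr_suml; apply/andP.
by split; apply: ler_sum => x /eqP <-; apply: ler_wpM2l => //; case/andP: (cdegree_close x j).
Qed.

(* The edges between the cluster of [i] and the neighbors of [i] in the cluster of [j],
   counted from both sides; the next lemma treats the non-neighbors likewise. *)
Lemma nbhd_degree_le (i j : T) :
  cweight i * (cdegree i j - th) <= cdegree i j * (cdegree j i + th).
Proof.
apply: (@le_trans _ R (\sum_(y | (rep y == j) && e i y) l y * cdegree y i)); last first.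
  rewrite /(cdegree i j) mulr_suml; apply: ler_sum => y /andP[/eqP <- _].
  by apply: ler_wpM2l => //; case/andP: (cdegree_close y i).
rewrite (exchange_sum_adj (fun y => (rep y == j) && e i y) (fun x => rep x == i)) //.
rewrite /cweight mulr_suml; apply: ler_sum => x /eqP <-; apply: ler_wpM2l => //.
have := nbhd_dist_sub e (fun y => (rep y == j) && e (rep x) y) (rep x) x l_ge0.
rewrite nbhd_distC (eq_bigl (fun y => (rep y == j) && e (rep x) y)) -/(cdegree _ _) => [|y].
  by have := rep_close x; move: (\sum_(y | _) _) => t; lra.
by rewrite -andbA andbb.
Qed.

Lemma non_nbhd_degree_le (i j : T) :
  (cweight j - cdegree i j) * (cdegree j i - th) <= cweight i * th.
Proof.
apply: (@le_trans _ R (\sum_(y | (rep y == j) && ~~ e i y) l y * cdegree y i)).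
  rewrite -cdegree_compl mulr_suml; apply: ler_sum => y /andP[/eqP <- _].
  by apply: ler_wpM2l => //; case/andP: (cdegree_close y i).
rewrite (exchange_sum_adj (fun y => (rep y == j) && ~~ e i y) (fun x => rep x == i)) //.
rewrite /cweight mulr_suml; apply: ler_sum => x /eqP <-; apply: ler_wpM2l => //.
have := nbhd_dist_sub e (fun y => (rep y == j) && ~~ e (rep x) y) x (rep x) l_ge0.
rewrite [X in _ <= X + _]big_pred0 => [|y]; last by rewrite -andbA andNb andbF.
by have := rep_close x; move: (\sum_(y | _) _) => t; lra.
Qed.

Lemma cdegree_dichotomy (i j : T) : 100 * th <= cweight i ->
  cdegree i j <= 3 * th \/ cweight j - cdegree i j <= 3 * th.
Proof.
move=> i_heavy; case: (leP (cdegree i j) (3 * th)) => nbr_gt; [by left | right].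
rewrite leNgt; apply/negP => non_nbr_gt; have th0 := th_gt0.
have := nbhd_degree_le i j; have := non_nbhd_degree_le i j.
move: (cdegree i j) (cweight j - cdegree i j) (cdegree j i) (cweight i) nbr_gt non_nbr_gt i_heavy.
move=> k k' kji wi k_gt k'_gt wi_ge non_nbhd_le nbhd_le.
have : 2 / 3 * wi <= kji + th.
  rewrite leNgt; apply/negP => lt.
  have : k * (kji + th) < k * (2 / 3 * wi) by rewrite ltr_pM2l //; lra.
  have : wi * (3 * th) < wi * k by rewrite ltr_pM2l //; lra.
  lra.
have : kji - th <= 1 / 3 * wi.
  rewrite leNgt; apply/negP => lt.
  have : k' * (1 / 3 * wi) < k' * (kji - th) by rewrite ltr_pM2l //; lra.
  have : wi * (3 * th) < wi * k' by rewrite ltr_pM2l //; lra.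
  lra.
lra.
Qed.

Definition heavy_cluster (i : T) : bool := 100 * th <= cweight i.

Definition cluster_rel : rel T := fun i j => cweight i * cweight j < 2 * cedges i j.

Lemma cluster_rel_sym : symmetric cluster_rel.
Proof. by move=> i j; rewrite /cluster_rel cedgesC mulrC. Qed.

Lemma cluster_rel_cdegree (i j : T) : heavy_cluster i -> heavy_cluster j -> cluster_rel i j ->
  cweight j - cdegree i j <= 3 * th.
Proof.
move=> i_heavy j_heavy; rewrite /cluster_rel.
case: (cdegree_dichotomy j i_heavy) => // nbr_le edges_gt; exfalso.
have /andP[_ edges_le] := cedges_bounds i j; have th0 := th_gt0.
move: i_heavy j_heavy edges_gt edges_le nbr_le; rewrite /heavy_cluster.
move: (cweight i) (cweight j) (cdegree i j) (cedges i j) => wi wj k eij.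
move=> wi_ge wj_ge edges_gt edges_le nbr_le.
have : wi * (k + th) <= wi * (4 * th) by rewrite ler_wpM2l //; lra.
have : wi * (100 * th) <= wi * wj by rewrite ler_wpM2l //; lra.
have : 0 < wi * th by rewrite mulr_gt0 //; lra.
lra.
Qed.

Lemma cluster_relN_cdegree (i j : T) : heavy_cluster i -> heavy_cluster j -> ~~ cluster_rel i j ->
  cdegree i j <= 3 * th.
Proof.
move=> i_heavy j_heavy; rewrite /cluster_rel -leNgt.
case: (cdegree_dichotomy j i_heavy) => // nbr_ge edges_le; exfalso.
have /andP[edges_ge _] := cedges_bounds i j; have th0 := th_gt0.
move: i_heavy j_heavy edges_ge edges_le nbr_ge; rewrite /heavy_cluster.
move: (cweight i) (cweight j) (cdegree i j) (cedges i j) => wi wj k eij.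
move=> wi_ge wj_ge edges_ge edges_le nbr_ge.
have : wi * (wj - 4 * th) <= wi * (k - th) by rewrite ler_wpM2l //; lra.
have : wi * (100 * th) <= wi * wj by rewrite ler_wpM2l //; lra.
have : 0 < wi * th by rewrite mulr_gt0 //; lra.
lra.
Qed.

Lemma cedges_triangle (i j k : T) :
  cedges j k <= (cweight j - cdegree i j) * cweight k + cdegree i j * (cweight k - cdegree i k).
Proof.
rewrite /(cedges j k) (bigID (e i)) /= addrC; apply: lerD.
  rewrite -cdegree_compl mulr_suml; apply: ler_sum => y _; apply: ler_wpM2l => //.
  exact: cdegree_le.
rewrite /(cdegree i j) mulr_suml; apply: ler_sum => y /andP[_ iy]; apply: ler_wpM2l => //.
rewrite -cdegree_compl; apply: ler_psum_sub => // z /andP[-> yz].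
exact: etf iy yz.
Qed.

Lemma cluster_rel_triangle_free (i j k : T) :
  heavy_cluster i -> heavy_cluster j -> heavy_cluster k ->
  cluster_rel i j -> cluster_rel j k -> ~~ cluster_rel i k.
Proof.
move=> i_heavy j_heavy k_heavy ij jk; apply/negP => ik; have th0 := th_gt0.
have := cluster_rel_cdegree i_heavy j_heavy ij; have := cluster_rel_cdegree i_heavy k_heavy ik.
have := cedges_triangle i j k; have := cdegree_ge0 i j.
have := cdegree_le i j.
move: j_heavy k_heavy jk; rewrite /heavy_cluster /cluster_rel.
move: (cweight j) (cweight k) (cdegree i j) (cdegree i k) (cedges j k) => wj wk kj kk ejk.
move=> wj_ge wk_ge edges_gt kj_le kj_ge0 edges_le kk_ge kj_ge.
have : (wj - kj) * wk <= 3 * th * wk by rewrite ler_wpM2r //; lra.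
have : kj * (wk - kk) <= kj * (3 * th) by rewrite ler_wpM2l //; lra.
have : wj * (100 * th) <= wj * wk by rewrite ler_wpM2l //; lra.
have : 100 * th * wk <= wj * wk by rewrite ler_wpM2r //; lra.
have : 0 < th * wk by rewrite mulr_gt0 //; lra.
have : kj * th <= wj * th by rewrite ler_wpM2r //; lra.
lra.
Qed.

Lemma cdegree_error (i j : T) : heavy_cluster i ->
  `|cdegree i j - (if heavy_cluster j && cluster_rel i j then cweight j else 0)| <= 103 * th.
Proof.
move=> i_heavy; have th0 := th_gt0; have := cdegree_ge0 i j; have := cdegree_le i j.
case: (boolP (heavy_cluster j)) => [j_heavy|]; last first.
  by rewrite /heavy_cluster -ltNge ler_norml /=; lra.
case: (boolP (cluster_rel i j)) => [ij|ij] /=.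
  by have := cluster_rel_cdegree i_heavy j_heavy ij; rewrite ler_norml; lra.
by have := cluster_relN_cdegree i_heavy j_heavy ij; rewrite ler_norml; lra.
Qed.

Hypothesis S8 : (#|S| <= 8)%N.

Lemma cluster_near_regular (r delta : R) : near_regular e l r delta -> 1000 * th <= delta ->
  near_regular (fun i j : {i in [set i in S | heavy_cluster i]} => cluster_rel (val i) (val j))
    (fun i => cweight (val i)) r (2 * delta).
Proof.
move=> [_ /andP[total_ge total_le] deg] th_le; have th0 := th_gt0.
have sum_const8 (C : R) : 0 <= C -> \sum_(j in S) C <= 8 * C.
  by move=> C0; rewrite sumr_const -[_ *+ _]mulr_natl ler_wpM2r // ler_nat.
have sum_heavy (P : pred T) (F : T -> R) :
    \sum_(i : {i in [set i in S | heavy_cluster i]} | P (val i)) F (val i) =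
    \sum_(i in S) (if heavy_cluster i && P i then F i else 0).
  rewrite -(big_sub_cond [set i in S | heavy_cluster i] P F) -big_mkcondr.
  by apply: eq_bigl => i; rewrite inE andbA.
have totalE : \sum_x l x = \sum_(i in S) cweight i.
  by rewrite (sum_partition xpredT); apply: eq_bigr => i _; apply: eq_bigl => x; rewrite andbT.
split=> [i||[i iH]]; first exact: cweight_ge0.
  rewrite (sum_heavy xpredT) /=; apply/andP; split; last first.
    apply: le_trans total_le; rewrite totalE; apply: ler_sum => i _.
    by case: ifP => // _; apply: cweight_ge0.
  have : \sum_(i in S) cweight i <=
      \sum_(i in S) ((if heavy_cluster i && true then cweight i else 0) + 100 * th).
    apply: ler_sum => i _; rewrite andbT; case: ifP => [_|/negbT]; first lra.
    by rewrite /heavy_cluster -ltNge; lra.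
  have c_ge0 : 0 <= 100 * th by lra.
  rewrite big_split -totalE /=; have := sum_const8 _ c_ge0.
  move: (\sum_(i in S) (100 * th)) (\sum_(i in S) _) => c h; lra.
have [iS i_heavy] : i \in S /\ heavy_cluster i by move: iH; rewrite inE => /andP[].
rewrite (sum_heavy (cluster_rel i)) /=; have := deg i; rewrite (sum_partition (e i)).
have : `|\sum_(j in S)
    (cdegree i j - (if heavy_cluster j && cluster_rel i j then cweight j else 0))| <=
    8 * (103 * th).
  have c_ge0 : 0 <= 103 * th by lra.
  apply: le_trans (sum_const8 _ c_ge0); apply: le_trans (ler_norm_sum _ _ _) _.
  by apply: ler_sum => j _; apply: cdegree_error.
rewrite sumrB ler_norml -/(\sum_(j in S) cdegree i j).
by move: (\sum_(j in S) cdegree i j) (\sum_(j in S) _) => k h; lra.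
Qed.

End Clusters.

Lemma few_separated_error_gt (R : realFieldType) (T : finType) (e : rel T) (l : T -> R)
    (r delta : R) :
  symmetric e -> triangle_free_rel e -> near_regular e l r delta ->
  (forall S, separated (nbhd_dist e l) (delta / 1000) S -> (#|S| <= 8)%N) ->
  0 < delta -> 4 / 11 <= r < 3 / 8 -> 3 / 8 - r < 12 * delta.
Proof.
move=> esym etf reg sep8 delta_gt0 r_range; have th_gt0 : 0 < delta / 1000 by lra.
have [S /sep8 S8 near] := maximal_separated th_gt0 (nbhd_distxx e l) (nbhd_distC e l).
pose rep x := s2val (sig2_eqW (near x)).
have rep_in x : rep x \in S by rewrite /rep; case: sig2_eqW.
have rep_close x : nbhd_dist e l x (rep x) < delta / 1000 by rewrite /rep; case: sig2_eqW.
have [l_ge0 _ _] := reg.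
have th_le : 1000 * (delta / 1000) <= delta by lra.
have regH := cluster_near_regular esym l_ge0 th_gt0 rep_in rep_close S8 reg th_le.
have -> : 12 * delta = 6 * (2 * delta) by ring.
apply: (small_near_regular_error_gt _ _ _ regH) r_range.
- rewrite card_sig; apply: leq_trans S8; apply: subset_leq_card.
  by apply/subsetP => i; rewrite !inE => /andP[].
- by move=> i j; apply: cluster_rel_sym.
move=> [i iH] [j jH] [k kH] /=; move: iH jH kH; rewrite !inE.
move=> /andP[_ i_heavy] /andP[_ j_heavy] /andP[_ k_heavy].
exact: (cluster_rel_triangle_free esym etf l_ge0 th_gt0 rep_close).
Qed.

(** * Cores of families of large independent sets *)

Definition indep_le (V : finType) (e : rel V) (s : nat) : Prop :=
  forall A, indep_set e A -> (#|A| <= s)%N.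

Definition large_indep (R : realFieldType) (V : finType) (e : rel V) (s : nat) (d : R) :
  pred {set V} := fun A => indep_set e A && (s%:R <= #|A|%:R + d).

Section CommonCore.

Variables (R : realFieldType) (V : finType) (e : rel V) (s : nat) (d : R).
Hypotheses (esym : symmetric e) (alpha : indep_le e s).

Definition core_pair (U0 C U : {set V}) : bool :=
  [&& C \subset U, U \subset U0 & [forall x in C, forall y in U, ~~ e x y]].

Lemma core_pair_shrink (U0 C U J : {set V}) : core_pair U0 C U -> indep_set e J ->
  J \subset U0 -> core_pair U0 (C :&: J) (U :|: J).
Proof.
move=> /and3P[CU UU0 /forall_inP CUe] /indep_setP indJ JU0; apply/and3P; split.
- by rewrite (subset_trans (subsetIl _ _)) // (subset_trans CU) ?subsetUl.
- by rewrite subUset UU0.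
apply/forall_inP => x /setIP[xC xJ]; apply/forall_inP => y /setUP[yU|yJ]; last exact: indJ.
by have /forall_inP := CUe x xC; apply.
Qed.

(* [(J :&: U) :|: C] is independent. *)
Lemma core_pair_loss (U0 C U J : {set V}) : core_pair U0 C U -> large_indep e s d J ->
  #|C :\: J|%:R <= #|J :\: U|%:R + d.
Proof.
move=> /and3P[/subsetP CU _ /forall_inP CUe] /andP[/indep_setP indJ s_le].
have noCU x y : x \in C -> y \in U -> ~~ e x y by move=> /CUe/forall_inP; apply.
have : (#|(J :&: U) :|: C| <= s)%N.
  apply/alpha/indep_setP => x y /setUP[/setIP[xJ xU]|xC] /setUP[/setIP[yJ yU]|yC].
  - exact: indJ.
  - by rewrite esym noCU.
  - exact: noCU.
  by rewrite noCU ?CU.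
have -> : #|(J :&: U) :|: C| = (#|J :&: U| + #|C :\: J|)%N.
  rewrite -(cardsID (J :&: U) (_ :|: C)) setUK setDUl setDv set0U; congr (_ + #|pred_of_set _|)%N.
  by apply/setP => x; rewrite !inE; case xC: (x \in C); rewrite ?andbF // CU // !andbT.
move: s_le; rewrite -(cardsID U J) natrD -(ler_nat R) natrD; lra.
Qed.

(* Replacing [(C, U)] by [(C :&: J, U :|: J)] decreases [#|C| + #|U|] by at most [d], so
   a pair that maximizes [t * (#|C| + #|U|) - d * #|C|] has [#|C :\: J| <= t]. *)
Lemma common_core (F : pred {set V}) (J0 U0 : {set V}) (t : R) :
  (forall J, F J -> large_indep e s d J /\ J \subset U0) -> F J0 -> 0 < d -> 0 < t ->
  exists2 C : {set V}, forall J, F J -> #|C :\: J|%:R <= t &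
    t * (2 * s%:R) <= t * (#|C|%:R + #|U0|%:R + 2 * d) + d * s%:R.
Proof.
move=> FP FJ0 d_gt0 t_gt0; have [/andP[indJ0 J0_ge] J0U0] := FP _ FJ0.
pose value (X : {set V} * {set V}) : R := t * (#|X.1|%:R + #|X.2|%:R) - d * #|X.1|%:R.
have J0_pair : core_pair U0 J0 J0 by rewrite /core_pair subxx J0U0.
pose good (X : {set V} * {set V}) := core_pair U0 X.1 X.2.
have [[C U] /= CU_pair CU_max] := @arg_maxP _ _ _ (J0, J0) good value J0_pair.
exists C => [J /FP[/[dup] J_large /andP[indJ _] JU0]|].
  have := CU_max (_, _) (core_pair_shrink CU_pair indJ JU0); rewrite leNgt => value_le.
  rewrite leNgt; apply: contra value_le => t_lt; rewrite /value /=.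
  have cardC : #|C|%:R = #|C :&: J|%:R + #|C :\: J|%:R :> R by rewrite -natrD cardsID.
  have -> : #|U :|: J|%:R = #|U|%:R + #|J :\: U|%:R :> R.
    by rewrite -natrD -(cardsID U (_ :|: _)) setUK setDUl setDv set0U.
  have : t * #|C :\: J|%:R <= t * (#|J :\: U|%:R + d).
    by rewrite ler_wpM2l ?(ltW t_gt0) ?(core_pair_loss CU_pair J_large).
  have : d * t < d * #|C :\: J|%:R by rewrite ltr_pM2l.
  rewrite cardC; lra.
have /and3P[_ UU0 _] := CU_pair.
have : t * #|U|%:R <= t * #|U0|%:R by rewrite ler_wpM2l ?(ltW t_gt0) // ler_nat subset_leq_card.
have : t * (2 * s%:R) <= t * (2 * (#|J0|%:R + d)) by rewrite ler_wpM2l ?(ltW t_gt0) //; lra.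
have : d * #|J0|%:R <= d * s%:R by rewrite ler_wpM2l ?(ltW d_gt0) // ler_nat alpha.
have : 0 <= d * #|C|%:R by rewrite mulr_ge0 // ltW.
by have := CU_max (J0, J0) J0_pair; rewrite /value /=; lra.
Qed.

End CommonCore.

Lemma bonferroni (I T : finType) (S : {set I}) (A : I -> {set T}) :
  (2 * \sum_(i in S) #|A i| <= 2 * #|\bigcup_(i in S) A i| +
    \sum_(i in S) \sum_(j in S | j != i) #|A i :&: A j|)%N.
Proof.
have cardE (B : {set T}) : #|B| = (\sum_x (x \in B))%N by rewrite -sum1_card big_mkcond.
pose m x := (\sum_(i in S) (x \in A i))%N.
have -> : (\sum_(i in S) #|A i| = \sum_x m x)%N.
  by rewrite exchange_big; apply: eq_bigr => i _; rewrite cardE.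
have -> : (\sum_(i in S) \sum_(j in S | j != i) #|A i :&: A j| = \sum_x m x * (m x).-1)%N.
  under eq_bigr => i _ do under eq_bigr => j _ do rewrite cardE.
  under eq_bigr => i _ do rewrite exchange_big.
  rewrite exchange_big; apply: eq_bigr => x _; rewrite big_distrl; apply: eq_bigr => i iS.
  under eq_bigr => j _ do rewrite inE -mulnb.
  rewrite -big_distrr /=; case xA: (x \in A i); rewrite ?mul0n // !mul1n.
  by rewrite /m [in RHS](bigD1 i) //= xA add1n.
rewrite (cardE (\bigcup_(i in S) A i)) !big_distrr -big_split; apply: leq_sum => x _ /=.
case: (posnP (m x)) => [->|m_gt0]; first by rewrite muln0.
have -> : x \in \bigcup_(i in S) A i.
  apply: contraLR m_gt0 => xA; rewrite -eqn0Ngt /m big1 // => i iS.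
  by apply/eqP; rewrite eqb0; apply: contra xA => xA; apply/bigcupP; exists i.
by case: (m x) m_gt0 => [|[|k]] // _; nia.
Qed.

(** * Random independent sets *)

Section Tolerances.

Variables (R : realFieldType) (f : R).

(* The tolerances are for probabilities, for the part of a core missed by a large independent
   set, and for the deficit of a large independent set, the latter two relative to [#|V|]. *)
Definition tolerance : R := f / 1000 / 100.
Definition core_tolerance : R := f * tolerance.
Definition size_tolerance : R := f * core_tolerance.

Hypothesis f_gt0 : 0 < f.

Lemma tolerance_gt0 : 0 < tolerance.
Proof. by rewrite /tolerance !divr_gt0. Qed.

Lemma core_tolerance_gt0 : 0 < core_tolerance.
Proof. by rewrite mulr_gt0 ?tolerance_gt0. Qed.

Lemma size_tolerance_gt0 : 0 < size_tolerance.
Proof. by rewrite mulr_gt0 ?core_tolerance_gt0. Qed.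

Hypothesis f_le : f <= 1 / 176.

Lemma core_tolerance_le : core_tolerance <= tolerance / 176.
Proof.
have : f * tolerance <= 1 / 176 * tolerance by rewrite ler_pM2r ?tolerance_gt0.
by rewrite /core_tolerance; lra.
Qed.

Lemma size_tolerance_le : size_tolerance <= core_tolerance / 176.
Proof.
have : f * core_tolerance <= 1 / 176 * core_tolerance by rewrite ler_pM2r ?core_tolerance_gt0.
by rewrite /size_tolerance; lra.
Qed.

Lemma core_tolerance_le_slack : core_tolerance <= f / 100.
Proof. by have := core_tolerance_le; have := f_gt0; rewrite /tolerance; lra. Qed.

Lemma size_tolerance_le_slack : size_tolerance <= f / 100.
Proof.
have := size_tolerance_le; have := core_tolerance_le_slack; have := core_tolerance_gt0.
lra.
Qed.

End Tolerances.

Definition indep_distribution (R : realFieldType) (V : finType) (e : rel V)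
    (lam : {set V} -> R) : Prop :=
  [/\ forall I, 0 <= lam I, forall I, lam I != 0 -> indep_set e I & \sum_I lam I = 1].

(* A random independent set that is large on average, avoids each large independent set
   with probability at least about [rho], and contains at most about the fraction [rho]
   of each set that is not too small. *)
Definition balanced_distribution (R : realFieldType) (V : finType) (e : rel V) (s : nat)
    (rho f : R) (lam : {set V} -> R) : Prop :=
  [/\ indep_distribution e lam,
      \sum_I lam I * (s%:R - #|I|%:R) <= size_tolerance f ^+ 2 * #|V|%:R,
      forall B, large_indep e s (size_tolerance f * #|V|%:R) B ->
        rho - 2 * tolerance f <= \sum_(I : {set V} | [disjoint B & I]) lam I &
      forall Y : {set V}, f * #|V|%:R <= #|Y|%:R ->
        \sum_I lam I * #|I :&: Y|%:R <= (rho + tolerance f) * #|Y|%:R].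

Section BalancedDistribution.

Variables (R : realFieldType) (V : finType) (e : rel V) (s : nat) (rho f : R).
Variable lam : {set V} -> R.

Local Notation n := (#|V|%:R : R).
Local Notation eta := (tolerance f).
Local Notation u := (core_tolerance f).
Local Notation b := (size_tolerance f).

Hypotheses (esym : symmetric e) (alpha : indep_le e s).
Hypotheses (n_gt0 : 0 < n) (f_gt0 : 0 < f).
Hypotheses (s_lo : 22 * f * n <= 11 * s%:R - 4 * n) (s_hi : 16 * f * n <= 3 * n - 8 * s%:R).
Hypothesis rho_ge : 4 / 11 <= rho.
Hypothesis balanced : balanced_distribution e s rho f lam.

Local Notation large := (large_indep e s (b * n)).
Local Notation I_large := {I : {set V} | large I}.

Definition avoid : rel I_large := fun A B => [disjoint val A & val B].

Definition mass (I : I_large) : R := lam (val I).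

Lemma slack_le : f <= 1 / 176.
Proof.
rewrite leNgt; apply/negP => f_gt; have : 1 / 176 * n < f * n by rewrite ltr_pM2r.
by have := s_lo; have := s_hi; have := n_gt0; lra.
Qed.

Lemma mass_ge0 (I : I_large) : 0 <= mass I.
Proof. by case: balanced => -[lam_ge0 _ _] _ _ _; apply: lam_ge0. Qed.

Lemma not_large_le : \sum_(I | ~~ large I) lam I <= b.
Proof.
have [[lam_ge0 lam_indep lam1] deficit _ _] := balanced.
have bn_gt0 : 0 < b * n by rewrite mulr_gt0 ?size_tolerance_gt0.
rewrite -(ler_pM2l bn_gt0); apply: le_trans (_ : b ^+ 2 * n <= _); last by lra.
apply: le_trans deficit; rewrite mulr_sumr [leLHS]big_mkcond; apply: ler_sum => I _.
have [->|/lam_indep indI] := eqVneq (lam I) 0; first by rewrite mul0r mulr0 if_same.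
case: ifP => [|_]; last by rewrite mulr_ge0 // subr_ge0 ler_nat alpha.
rewrite /large_indep indI /= -ltNge => I_lt; rewrite mulrC ler_wpM2l //; lra.
Qed.

Lemma sum_le_mass (P : pred {set V}) :
  \sum_(I | P I) lam I <= \sum_(I : I_large | P (val I)) mass I + b.
Proof.
have [[lam_ge0 _ _] _ _ _] := balanced.
rewrite (bigID large) /=; apply: lerD.
  by under eq_bigl do rewrite andbC; rewrite (big_sub_cond large P lam).
by apply: le_trans not_large_le; apply: ler_psum_sub => // I /andP[].
Qed.

Lemma mass_le1 (P : pred I_large) : \sum_(I | P I) mass I <= 1.
Proof.
have [[lam_ge0 _ lam1] _ _ _] := balanced; rewrite -[leRHS]lam1.
apply: le_trans (_ : \sum_(I : I_large) mass I <= _).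
  by apply: ler_psum_sub => //; apply: mass_ge0.
by rewrite -(big_sub large lam); apply: ler_psum_sub.
Qed.

Lemma avoid_mass_ge (A : I_large) : rho - 3 * eta <= \sum_(I | avoid A I) mass I.
Proof.
have [_ _ avoid_ge _] := balanced; have := avoid_ge _ (valP A).
have := sum_le_mass (fun I => [disjoint val A & I]).
have := size_tolerance_le f_gt0 slack_le; have := core_tolerance_le f_gt0 slack_le.
have := tolerance_gt0 f_gt0; rewrite /avoid.
by move: (\sum_(I | _) _) (\sum_(I : I_large | _) _) => p q; lra.
Qed.

Lemma mass_concentration (P : pred I_large) (Z : {set V}) : f * n <= #|Z|%:R ->
  (forall I, P I -> #|Z :\: val I|%:R <= u * n) -> \sum_(I | P I) mass I <= rho + 2 * eta.
Proof.
have [[lam_ge0 _ _] _ _ hit] := balanced => Z_ge ZP.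
have Z_gt0 : 0 < #|Z|%:R :> R by apply: lt_le_trans Z_ge; rewrite mulr_gt0.
have un_ge0 : 0 <= u * n by rewrite mulr_ge0 ?ltW ?core_tolerance_gt0.
set p := \sum_(I | P I) mass I.
have : p * (#|Z|%:R - u * n) <= (rho + eta) * #|Z|%:R.
  apply: le_trans (hit Z Z_ge); apply: (@le_trans _ R (\sum_I mass I * #|val I :&: Z|%:R)).
    rewrite /p mulr_suml [leLHS]big_mkcond; apply: ler_sum => I _; case: ifP => [/ZP PI|_].
      apply: ler_wpM2l; first exact: mass_ge0.
      have := cardsID (val I) Z; rewrite setIC => /(congr1 (fun k => k%:R : R)).
      by rewrite natrD; lra.
    by rewrite mulr_ge0 ?mass_ge0.
  rewrite -(big_sub large (fun I => lam I * #|I :&: Z|%:R)).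
  by apply: ler_psum_sub => // I; rewrite mulr_ge0.
have : p * (u * n) <= eta * #|Z|%:R.
  apply: le_trans (_ : u * n <= _); first by rewrite ler_piMl ?mass_le1.
  rewrite /core_tolerance -mulrA mulrCA; apply: ler_wpM2l Z_ge.
  exact/ltW/tolerance_gt0.
by move=> p_un p_Z; rewrite -(ler_pM2r Z_gt0); lra.
Qed.

Definition is_core (A : I_large) (X : {set V}) : bool :=
  [forall (I | avoid A I), #|X :\: val I|%:R <= u * n] &&
  (3 * s%:R - n - 2 * f * n <= #|X|%:R).

Lemma exists_core (A : I_large) : exists X, is_core A X.
Proof.
have /andP[_ A_ge] := valP A; have bn_gt0 : 0 < b * n by rewrite mulr_gt0 ?size_tolerance_gt0.
have un_gt0 : 0 < u * n by rewrite mulr_gt0 ?core_tolerance_gt0.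
have [J AJ] : exists J, avoid A J.
  apply/existsP; apply: contraT => /existsPn noJ; have := avoid_mass_ge A; rewrite big_pred0.
    have := rho_ge; have := slack_le; rewrite /tolerance; lra.
  by move=> J; apply/negbTE/noJ.
pose F J := large J && [disjoint val A & J].
have FP I : F I -> large_indep e s (b * n) I /\ I \subset ~: val A.
  by case/andP => I_large' AI; rewrite -disjoints_subset disjoint_sym.
have FJ : F (val J) by rewrite /F (valP J).
have [X XP X_ge] := common_core esym alpha FP FJ bn_gt0 un_gt0; exists X; apply/andP; split.
  by apply/forall_inP => I AI; apply: XP; rewrite /F (valP I).
have cardA : #|val A|%:R + #|~: val A|%:R = n by rewrite -natrD cardsC.
have : u * n * (2 * s%:R) <= u * n * (#|X|%:R + #|~: val A|%:R + 2 * (b * n) + f * s%:R).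
  by move: X_ge; rewrite /size_tolerance; lra.
rewrite ler_pM2l //.
have : f * s%:R <= f * (3 / 8 * n).
  have fn_gt0 : 0 < f * n by rewrite mulr_gt0.
  by rewrite ler_pM2l //; have := s_hi; lra.
have : b * n <= f / 100 * n.
  by rewrite ler_pM2r //; exact: size_tolerance_le_slack f_gt0 slack_le.
by move: A_ge; rewrite /=; lra.
Qed.

Definition core (A : I_large) : {set V} := xchoose (exists_core A).

Lemma core_near (A I : I_large) : avoid A I -> #|core A :\: val I|%:R <= u * n.
Proof. by move=> AI; have /andP[/forall_inP + _] := xchooseP (exists_core A); apply. Qed.

Lemma core_ge (A : I_large) : 3 * s%:R - n - 2 * f * n <= #|core A|%:R.
Proof. by have /andP[] := xchooseP (exists_core A). Qed.

Lemma avoid_mass_le (A : I_large) : \sum_(I | avoid A I) mass I <= rho + 2 * eta.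
Proof.
apply: (mass_concentration _ (@core_near A)); apply: le_trans (core_ge A).
by have := s_lo; have := n_gt0; have := mulr_gt0 f_gt0 n_gt0; lra.
Qed.

Lemma avoid_sym : symmetric avoid.
Proof. by move=> A B; rewrite /avoid disjoint_sym. Qed.

Lemma avoid_triangle_free : triangle_free_rel avoid.
Proof.
move=> A B C AB BC; apply/negP => AC.
have : (#|val A| + #|val B| + #|val C| <= #|V|)%N.
  have := cardsUI (val A) (val B); have := cardsUI (val A :|: val B) (val C).
  rewrite setIUl (disjoint_setI0 AB) (disjoint_setI0 AC) (disjoint_setI0 BC) setU0 cards0.
  by rewrite !addn0 => cardABC cardAB; rewrite -cardAB -cardABC max_card.
rewrite -(ler_nat R) !natrD.
have /andP[_ A_ge] := valP A; have /andP[_ B_ge] := valP B; have /andP[_ C_ge] := valP C.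
have : b * n <= f * n.
  by rewrite ler_pM2r //; have := size_tolerance_le_slack f_gt0 slack_le; have := f_gt0; lra.
by have := s_lo; have := n_gt0; have := mulr_gt0 f_gt0 n_gt0; lra.
Qed.

Lemma avoid_near_regular : near_regular avoid mass rho (f / 6).
Proof.
have eta_gt0 := tolerance_gt0 f_gt0; have eta_le : 3 * eta <= f / 6.
  by have := f_gt0; rewrite /tolerance; lra.
have b_le : b <= f / 6.
  by have := size_tolerance_le_slack f_gt0 slack_le; have := f_gt0; lra.
split=> [I||A]; first exact: mass_ge0.
  have := sum_le_mass xpredT; case: balanced => -[_ _ ->] _ _ _.
  by rewrite mass_le1 andbT => ?; lra.
by have := avoid_mass_ge A; have := avoid_mass_le A; lra.
Qed.

Lemma cores_almost_disjoint (A B : I_large) : f / 6 / 1000 <= nbhd_dist avoid mass A B ->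
  #|core A :&: core B|%:R < f * n.
Proof.
move=> dist_ge; rewrite ltNge; apply/negP => Z_ge.
have : \sum_(I | avoid A I || avoid B I) mass I <= rho + 2 * eta.
  apply: (mass_concentration Z_ge) => I /orP[/core_near|/core_near]; apply: le_trans.
    by rewrite ler_nat subset_leq_card // setSD // subsetIl.
  by rewrite ler_nat subset_leq_card // setSD // subsetIr.
have : 2 * \sum_(I | avoid A I || avoid B I) mass I =
    \sum_(I | avoid A I) mass I + \sum_(I | avoid B I) mass I + nbhd_dist avoid mass A B.
  rewrite /nbhd_dist [\sum_(I | avoid A I || _) _]big_mkcond [\sum_(I | avoid A I) _]big_mkcond.
  rewrite [\sum_(I | avoid B I) _]big_mkcond [\sum_(I | _ != _) _]big_mkcond.
  rewrite -!big_split /= mulr_sumr.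
  apply: eq_bigr => I _; move: (mass I) => p.
  by case: (avoid A I); case: (avoid B I) => /=; lra.
have := avoid_mass_ge A; have := avoid_mass_ge B; have := f_gt0; move: dist_ge.
move: (\sum_(I | avoid A I || _) _) (\sum_(I | avoid A I) _) (\sum_(I | avoid B I) _).
by move: (nbhd_dist _ _ _ _) => dAB pAB pA pB; rewrite /tolerance; lra.
Qed.

Lemma card_avoided_le3 (S : {set I_large}) (I : I_large) :
  separated (nbhd_dist avoid mass) (f / 6 / 1000) S -> (#|[set A in S | avoid A I]| <= 3)%N.
Proof.
move=> /separatedP sepS; rewrite leqNgt; apply/negP => card_gt3.
have [Q] : exists Q, Q \in [set Q : {set I_large} |
    (Q \subset [set A in S | avoid A I]) && (#|Q| == 4%N)].
  by apply/card_gt0P; rewrite cards_draws bin_gt0.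
rewrite inE => /andP[/subsetP QS /eqP Q4].
have {}QS A : A \in Q -> A \in S /\ avoid A I by move/QS; rewrite inE => /andP[].
have := bonferroni Q (fun A => val I :&: core A); rewrite -(ler_nat R) natrD !natrM !natr_sum.
have : #|\bigcup_(A in Q) (val I :&: core A)|%:R <= s%:R :> R.
  rewrite ler_nat; apply: (@leq_trans #|val I|); last by apply: alpha; case/andP: (valP I).
  by apply/subset_leq_card/bigcupsP => A _; apply: subsetIl.
have : \sum_(A in Q) (3 * s%:R - n - 2 * f * n - u * n) <=
    \sum_(A in Q) #|val I :&: core A|%:R :> R.
  apply: ler_sum => A /QS[_ AI]; have := core_ge A; have := core_near AI.
  have := cardsID (val I) (core A); rewrite setIC => /(congr1 (fun k => k%:R : R)).
  by rewrite natrD; lra.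
have : \sum_(A in Q) (\sum_(B in Q | B != A) #|val I :&: core A :&: (val I :&: core B)|)%N%:R <=
    \sum_(A in Q) 3 * (f * n).
  apply: ler_sum => A AQ; rewrite natr_sum.
  have -> : 3 * (f * n) = \sum_(B in Q | B != A) f * n.
    rewrite (eq_bigl (fun B => B \in Q :\ A)) => [|B]; last by rewrite !inE andbC.
    have -> : 3 = #|Q :\ A|%:R :> R by move: Q4; rewrite (cardsD1 A) AQ add1n => -[->].
    by rewrite sumr_const mulr_natl.
  apply: ler_sum => B /andP[BQ BA].
  have [[AS _] [BS _]] := (QS A AQ, QS B BQ).
  apply: le_trans (ltW (cores_almost_disjoint (sepS A B AS BS _))); last by rewrite eq_sym.
  by rewrite ler_nat subset_leq_card // setISS // subsetIr.
rewrite !sumr_const Q4.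
have : u * n <= f * n.
  by rewrite ler_pM2r //; have := core_tolerance_le_slack f_gt0 slack_le; have := f_gt0; lra.
by have := s_lo; have := mulr_gt0 f_gt0 n_gt0; lra.
Qed.

Lemma separated_card_le8 (S : {set I_large}) :
  separated (nbhd_dist avoid mass) (f / 6 / 1000) S -> (#|S| <= 8)%N.
Proof.
move=> sepS; rewrite leqNgt; apply/negP => S9.
have : \sum_(A in S) \sum_(I | avoid A I) mass I <= 3.
  rewrite (exchange_big_dep xpredT) //=.
  apply: le_trans (_ : \sum_I mass I * 3 <= _); last first.
    by rewrite -mulr_suml; have := mass_le1 xpredT; lra.
  apply: ler_sum => I _; rewrite (eq_bigl (fun A => A \in [set A in S | avoid A I])) => [|A].
    by rewrite sumr_const -[mass I *+ _]mulr_natr ler_wpM2l ?mass_ge0 // ler_nat card_avoided_le3.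
  by rewrite inE.
have : \sum_(A in S) (rho - 3 * eta) <= \sum_(A in S) \sum_(I | avoid A I) mass I.
  by apply: ler_sum => A _; apply: avoid_mass_ge.
have eta_le : 1000 * eta <= 1 by have := slack_le; rewrite /tolerance; lra.
rewrite sumr_const -[_ *+ _]mulr_natl.
have : 9 * (rho - 3 * eta) <= #|S|%:R * (rho - 3 * eta).
  by rewrite ler_wpM2r ?ler_nat //; have := rho_ge; lra.
by have := rho_ge; move: (\sum_(A in S) _) => t; lra.
Qed.

(* The relation of disjointness between large independent sets is nearly a blow-up of a
   graph on at most eight vertices, with degrees about [rho]. *)
Lemma balanced_distribution_rho_gt : 3 / 8 - 2 * f < rho.
Proof.
have f_gt := f_gt0; case: (ltP rho (3 / 8)) => [rho_lt|]; last by lra.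
have := few_separated_error_gt avoid_sym avoid_triangle_free avoid_near_regular
  separated_card_le8.
by rewrite rho_ge rho_lt => /(_ ltac:(lra) isT); lra.
Qed.

End BalancedDistribution.

(** * Blow-ups and the extremal function *)

Lemma adj_sym (V : finType) (E : {set {set V}}) : symmetric (adj E).
Proof. by move=> x y; rewrite /adj setUC. Qed.

Lemma triangle_free_adj (V : finType) (E : {set {set V}}) :
  reflect (triangle_free_rel (adj E)) (triangle_free E).
Proof.
apply: (iffP existsPn) => [tf x y z xy yz|tf x].
  by have /existsPn/(_ y)/existsPn/(_ z) := tf x; rewrite xy yz.
apply/existsPn => y; apply/existsPn => z; apply/and3P => -[xy yz xz].
by have := tf _ _ _ xy yz; rewrite xz.
Qed.

Lemma eq_set2 (T : finType) (a b x y : T) :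
  ([set a; b] == [set x; y]) = ((x == a) && (y == b)) || ((x == b) && (y == a)).
Proof.
apply/eqP/orP => [E|[/andP[/eqP-> /eqP->]|/andP[/eqP-> /eqP->]]] //; last by rewrite setUC.
have /set2P xab : x \in [set a; b] by rewrite E set21.
have /set2P yab : y \in [set a; b] by rewrite E set22.
have /set2P axy : a \in [set x; y] by rewrite -E set21.
have /set2P bxy : b \in [set x; y] by rewrite -E set22.
case: xab axy bxy => -> axy bxy; [left | right]; rewrite eqxx /=; apply/eqP.
  by case: yab bxy => -> // -[].
by case: yab axy => -> // -[].
Qed.

Lemma sum_adj (V : finType) (E : {set {set V}}) : simple_graph E ->
  (\sum_x \sum_y adj E x y = 2 * #|E|)%N.
Proof.
move=> /forall_inP simple; rewrite pair_big /=.
rewrite (eq_bigr (fun p : V * V => \sum_(A in E) (A == [set p.1; p.2])))%N; last first.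
  move=> [x y] _ /=; rewrite /adj; case: (boolP (_ \in E)) => xyE.
    by rewrite (bigD1 _ xyE) eqxx big1 //= => A /andP[_ /negbTE->].
  by rewrite big1 // => A AE; case: eqP => // A_xy; rewrite -A_xy AE in xyE.
rewrite exchange_big /= mulnC -sum_nat_const; apply: eq_bigr => A AE.
have /cards2P[a [b [ab ->]]] := simple A AE.
rewrite (bigD1 (a, b)) //= (bigD1 (b, a)) /=; last by rewrite xpair_eqE eq_sym (negbTE ab).
rewrite !eq_set2 !eqxx orbT big1 // => -[x y] /andP[/= n1 n2].
by rewrite eq_set2; move: n1 n2; rewrite !xpair_eqE => /negbTE-> /negbTE->.
Qed.

Definition admissible (n s : nat) (E : {set {set 'I_n}}) : bool :=
  [&& simple_graph E, triangle_free E
    & [forall A : {set 'I_n}, independent E A ==> (#|A| <= s)%N]].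

Lemma admissibleP (n s : nat) (E : {set {set 'I_n}}) :
  reflect [/\ simple_graph E, triangle_free_rel (adj E) & indep_le (adj E) s]
    (admissible s E).
Proof.
apply: (iffP and3P) => -[sE tE aE]; split=> //; try exact/triangle_free_adj.
  by move=> A; apply/implyP/(forallP aE).
by apply/forallP => A; apply/implyP/aE.
Qed.

Lemma ex_tf_attained (n s : nat) : (0 < ex_tf n s)%N ->
  exists2 E : {set {set 'I_n}}, admissible s E & #|E| = ex_tf n s.
Proof.
move=> ex_gt0; have adm_gt0 : (0 < #|@admissible n s|)%N.
  apply: contraLR ex_gt0; rewrite -!eqn0Ngt => /eqP/card0_eq no_adm.
  by rewrite /ex_tf big_pred0 // => E; apply: no_adm.
have [E adm maxE] := eq_bigmax_cond (fun E : {set {set 'I_n}} => #|E|) adm_gt0.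
by exists E => //; rewrite -maxE.
Qed.

Lemma admissible_le_ex_tf (n s : nat) (E : {set {set 'I_n}}) :
  admissible s E -> (#|E| <= ex_tf n s)%N.
Proof. by move=> adm; apply: (leq_bigmax_cond (P := admissible s)). Qed.

Lemma triangle_free_degree_le (V : finType) (e : rel V) (s : nat) (u : V) :
  symmetric e -> triangle_free_rel e -> indep_le e s -> (\sum_v e u v <= s)%N.
Proof.
move=> esym etf alpha; apply: leq_trans (alpha _ (indep_nbhd u etf esym)).
by rewrite -sum1_card [leqRHS]big_mkcond; apply: leq_sum => v _; rewrite inE; case: (e u v).
Qed.

Lemma ex_tf_degree_bound (n s : nat) : (2 * ex_tf n s <= n * s)%N.
Proof.
case: (posnP (ex_tf n s)) => [->|/ex_tf_attained[E /admissibleP[sE tE aE] <-]].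
  by rewrite muln0.
have -> : (n * s = \sum_(x < n) s)%N by rewrite sum_nat_const card_ord.
rewrite -sum_adj //; apply: leq_sum => x _.
by apply: triangle_free_degree_le aE; first exact: adj_sym.
Qed.

Lemma rel_le_ex_tf (V : finType) (e : rel V) (s : nat) :
  symmetric e -> triangle_free_rel e -> indep_le e s ->
  (\sum_x \sum_y e x y <= 2 * ex_tf #|V| s)%N.
Proof.
move=> esym etf alpha; pose v : 'I_#|V| -> V := enum_val.
pose E := [set A : {set 'I_#|V|} | [exists x, exists y, e (v x) (v y) && (A == [set x; y])]].
have adjE x y : adj E x y = e (v x) (v y).
  rewrite /adj inE; apply/existsP/idP => [[a /existsP[b /andP[ab]]]|xy]; last first.
    by exists x; apply/existsP; exists y; rewrite xy eqxx.
  by rewrite eq_set2 => /orP[] /andP[/eqP <- /eqP <-] //; rewrite esym.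
have simpleE : simple_graph E.
  apply/forall_inP => A; rewrite inE => /existsP[x /existsP[y /andP[xy /eqP->]]].
  rewrite cards2 eqSS eqb1; apply: contraTneq xy => ->.
  by rewrite (triangle_free_irr etf).
have admE : admissible s E.
  apply/admissibleP; split=> // [x y z|A /indep_setP indA]; first by rewrite !adjE; apply: etf.
  rewrite -(card_imset _ enum_val_inj) alpha //.
  apply/indep_setP => _ _ /imsetP[x xA ->] /imsetP[y yA ->].
  by rewrite -adjE indA.
apply: leq_trans (_ : 2 * #|E| <= _)%N; last by rewrite leq_mul2l admissible_le_ex_tf.
rewrite -sum_adj // (reindex v) /=; last exact: onW_bij (enum_val_bij V).
apply: leq_sum => x _; rewrite (reindex v) /=; last exact: onW_bij (enum_val_bij V).
by apply: leq_sum => y _; rewrite adjE.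
Qed.

Section BlowUp.

Variables (T : finType) (e : rel T) (w : T -> nat).

Definition blowup : rel {x : T & 'I_(w x)} := fun u v => e (tag u) (tag v).

Lemma sum_blowup (P : pred T) (F : T -> nat) :
  (\sum_(u : {x : T & 'I_(w x)} | P (tag u)) F (tag u) = \sum_(x | P x) w x * F x)%N.
Proof.
rewrite (eq_bigl (fun u : {x : T & 'I_(w x)} => P (tag u) && true)) => [|u]; last first.
  by rewrite andbT.
rewrite -(sig_big_dep (J := fun x => 'I_(w x)) P (fun _ => xpredT) (fun x _ => F x)).
by apply: eq_bigr => x _; rewrite sum_nat_const card_ord.
Qed.

Lemma card_blowup : #|{: {x : T & 'I_(w x)}}| = (\sum_x w x)%N.
Proof.
rewrite -sum1_card; have := sum_blowup xpredT (fun=> 1%N) => /= ->.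
by apply: eq_bigr => x _; rewrite muln1.
Qed.

Lemma blowup_indep_le (s : nat) :
  (forall A, indep_set e A -> (\sum_(x in A) w x <= s)%N) -> indep_le blowup s.
Proof.
move=> alpha A /indep_setP indA; pose B := [set tag u | u in A].
apply: leq_trans (alpha B _); last first.
  by apply/indep_setP => _ _ /imsetP[u uA ->] /imsetP[v vA ->]; apply: indA.
have := sum_blowup (mem B) (fun=> 1%N); under [RHS]eq_bigr do rewrite muln1.
move=> <-; rewrite -sum1_card [leqLHS]big_mkcond [leqRHS]big_mkcond; apply: leq_sum => u _.
by case: ifP => // uA; rewrite /= imset_f.
Qed.

Lemma blowup_le_ex_tf (s : nat) : symmetric e -> triangle_free_rel e ->
  (forall A, indep_set e A -> (\sum_(x in A) w x <= s)%N) ->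
  (\sum_x \sum_y e x y * (w x * w y) <= 2 * ex_tf (\sum_x w x) s)%N.
Proof.
move=> esym etf /blowup_indep_le alpha; rewrite -card_blowup.
apply: leq_trans (rel_le_ex_tf _ _ alpha) => [|u v|u v z]; [|exact: esym|exact: etf].
rewrite [leqRHS](eq_bigr (fun u => \sum_y w y * e (tag u) y)%N) => [|u _]; last first.
  exact: (sum_blowup xpredT (fun y => e (tag u) y)).
rewrite (sum_blowup xpredT (fun x => \sum_y w y * e x y))%N; apply: leq_sum => x _.
by rewrite big_distrr; apply: leq_sum => y _; rewrite /= mulnC -mulnA [(w y * _)%N]mulnC.
Qed.

End BlowUp.

(** * Theorem of the alternative *)

Lemma seq_between (R : realFieldType) (A B : seq R) :
  (forall a b, a \in A -> b \in B -> a < b) ->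
  exists2 t, forall a, a \in A -> a < t & forall b, b \in B -> t < b.
Proof.
move=> AB; pose lowB := \big[Num.min/0]_(b <- B) b.
pose maxA := \big[Num.max/(lowB - 1)]_(a <- A) a.
have maxA_lt b : b \in B -> maxA < b.
  move=> bB; rewrite /maxA big_seq; apply: bigmax_lt => [|a aA]; last exact: AB.
  have : lowB <= b by exact: (ge_bigmin_seq _ _ xpredT id bB).
  lra.
pose minB := \big[Num.min/(maxA + 1)]_(b <- B) b.
have lt_minB : maxA < minB.
  by rewrite /minB big_seq; apply: lt_bigmin => [|b]; [lra | apply: maxA_lt].
exists ((maxA + minB) / 2) => [a aA|b bB].
  have : a <= maxA by exact: (le_bigmax_seq _ _ xpredT id aA).
  lra.
have : minB <= b by exact: (ge_bigmin_seq _ _ xpredT id bB).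
lra.
Qed.

Inductive pos_cone (R : realFieldType) (I : finType) (L : seq {ffun I -> R^o}) :
    {ffun I -> R^o} -> Prop :=
| pos_cone_mem v : v \in L -> pos_cone L v
| pos_cone_add u v : pos_cone L u -> pos_cone L v -> pos_cone L (u + v)
| pos_cone_scale a u : 0 < a -> pos_cone L u -> pos_cone L (a *: u).

Section FourierMotzkin.

Variables (R : realFieldType) (I : finType).
Implicit Types (u v w : {ffun I -> R^o}) (L : seq {ffun I -> R^o}).

Definition eliminate (r : I) L : seq {ffun I -> R^o} :=
  [seq v : {ffun I -> R^o} <- L | 0 <= (v r : R)] ++
  [seq (v r : R) *: w - (w r : R) *: v |
     v : {ffun I -> R^o} <- [seq v : {ffun I -> R^o} <- L | 0 < (v r : R)],
     w : {ffun I -> R^o} <- [seq w : {ffun I -> R^o} <- L | (w r : R) < 0]].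

Lemma mem_eliminate_ge0 (r : I) L v : v \in L -> 0 <= (v r : R) -> v \in eliminate r L.
Proof. by move=> vL v_ge0; rewrite mem_cat mem_filter v_ge0 vL. Qed.

Lemma mem_eliminate_pair (r : I) L v w : v \in L -> w \in L -> 0 < (v r : R) -> (w r : R) < 0 ->
  (v r : R) *: w - (w r : R) *: v \in eliminate r L.
Proof.
move=> vL wL v_gt0 w_lt0; rewrite mem_cat; apply/orP; right; apply/allpairsP.
by exists (v, w); rewrite !mem_filter v_gt0 w_lt0 vL wL.
Qed.

Lemma pos_cone_eliminate (r : I) L u : pos_cone (eliminate r L) u ->
  pos_cone L u /\ 0 <= (u r : R).
Proof.
elim=> {u} [v|u v _ [uL u_ge0] _ [vL v_ge0]|a u a_gt0 _ [uL u_ge0]].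
- rewrite mem_cat => /orP[|/allpairsP[[v' w] [/=]]].
    by rewrite mem_filter => /andP[v_ge0 vL]; split; first exact: pos_cone_mem.
  rewrite !mem_filter => /andP[v_gt0 vL] /andP[w_lt0 wL] ->; split.
    rewrite -scaleNr; apply: pos_cone_add; apply: pos_cone_scale; rewrite ?oppr_gt0 //;
    exact: pos_cone_mem.
  by rewrite !ffunE /GRing.scale /= mulrC subrr.
- by split; [exact: pos_cone_add | rewrite !ffunE addr_ge0].
by split; [exact: pos_cone_scale | rewrite !ffunE mulr_ge0 // ltW].
Qed.

Lemma eliminate_extend (r : I) L (h : {ffun I -> R^o} -> R) :
  (forall v w (a b : R), h (a *: w - b *: v) = a * h w - b * h v) ->
  (forall v, v \in eliminate r L -> h v < 0) ->
  exists2 t, 0 <= t & forall v, v \in L -> t * (v r : R) + h v < 0.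
Proof.
move=> h_lin h_lt0.
pose A := 0 :: [seq h w / - (w r : R) | w : {ffun I -> R^o} <- L & (w r : R) < 0].
pose B := [seq - h v / (v r : R) | v : {ffun I -> R^o} <- L & 0 < (v r : R)].
have AB a b : a \in A -> b \in B -> a < b.
  rewrite inE => aA /mapP[v]; rewrite mem_filter => /andP[v_gt0 vL] ->.
  move: aA => /orP[/eqP->|/mapP[w]].
    by rewrite divr_gt0 // oppr_gt0 h_lt0 // mem_eliminate_ge0 // ltW.
  rewrite mem_filter => /andP[w_lt0 wL] ->.
  rewrite ltr_pdivrMr ?oppr_gt0 // mulrAC ltr_pdivlMr //.
  by have := h_lt0 _ (mem_eliminate_pair vL wL v_gt0 w_lt0); rewrite h_lin; lra.
have [t tA tB] := seq_between AB; exists t => [|v vL]; first exact/ltW/tA/mem_head.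
case: (ltrgt0P (v r : R)) => [v_gt0|v_lt0|v_eq0].
- have : t < - h v / v r by apply: tB; apply/mapP; exists v; rewrite ?mem_filter ?v_gt0.
  by rewrite ltr_pdivlMr //; lra.
- have : h v / - v r < t by apply/tA/predU1r/mapP; exists v; rewrite ?mem_filter ?v_lt0.
  by rewrite ltr_pdivrMr ?oppr_gt0 //; lra.
by rewrite v_eq0 mulr0 add0r h_lt0 // mem_eliminate_ge0 // v_eq0.
Qed.

Lemma cone_alternative (rs : seq I) L : uniq rs ->
  (exists2 y : I -> R, forall i, 0 <= y i &
     forall v, v \in L -> \sum_(i <- rs) y i * v i < 0) \/
  (exists2 u, pos_cone L u & forall i, i \in rs -> 0 <= u i).
Proof.
elim: rs L => [|r rs IH] L /=.
  case: L => [|v L] _; first by left; exists (fun=> 0).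
  by right; exists v => //; apply: pos_cone_mem; rewrite mem_head.
move=> /andP[r_rs rs_uniq]; have [[y y_ge0 y_lt0]|[u uL u_ge0]] := IH (eliminate r L) rs_uniq.
  left; have [v w a b|t t_ge0 tP] := eliminate_extend _ y_lt0.
    by rewrite !mulr_sumr -sumrB; apply: eq_bigr => i _; rewrite !ffunE /GRing.scale /=; ring.
  exists (fun i => if i == r then t else y i) => [i|v vL]; first by case: eqP.
  rewrite big_cons eqxx (eq_big_seq (fun i => y i * v i)) ?tP // => i i_rs.
  by case: eqP => // i_r; move: r_rs; rewrite -i_r i_rs.
right; have [uL' ur_ge0] := pos_cone_eliminate uL; exists u => // i.
by rewrite inE => /predU1P[->|/u_ge0].
Qed.

End FourierMotzkin.

Section Ville.

Variables (R : realFieldType) (I J : finType) (P : pred I) (Q : pred J) (M : I -> J -> R).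

Definition column (j : J) : {ffun I -> R^o} := [ffun i => M i j].

Lemma pos_cone_columns (u : {ffun I -> R^o}) : pos_cone [seq column j | j <- enum Q] u ->
  exists2 lam : J -> R,
    [/\ forall j, 0 <= lam j, forall j, lam j != 0 -> Q j & 0 < \sum_j lam j] &
    forall i, u i = \sum_j lam j * M i j.
Proof.
elim=> {u} [v /mapP[j Qj ->]|u v _ [l1 [ge1 Q1 gt1] E1] _ [l2 [ge2 Q2 gt2] E2]|
  a u a_gt0 _ [l1 [ge1 Q1 gt1] E1]].
- rewrite mem_enum in Qj; exists (fun k => (k == j)%:R) => [|i]; last first.
    rewrite ffunE (bigD1 j) //= eqxx mul1r big1 ?addr0 // => k /negbTE->; exact: mul0r.
  split=> [k|k|]; first exact: ler0n.
    by have [->|_] := eqVneq k j; rewrite ?eqxx.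
  by rewrite (bigD1 j) //= eqxx ltr_pwDl ?sumr_ge0.
- exists (fun j => l1 j + l2 j) => [|i].
    split=> [j|j|]; [exact: addr_ge0 | | by rewrite big_split addr_gt0].
    by have [->|/Q1] := eqVneq (l1 j) 0; [rewrite add0r => /Q2|].
  by rewrite !ffunE E1 E2 -big_split; apply: eq_bigr => j _; rewrite mulrDl.
exists (fun j => a * l1 j) => [|i].
  split=> [j|j|]; first by rewrite mulr_ge0 // ltW.
    by rewrite mulf_eq0 negb_or => /andP[_ /Q1].
  by rewrite -mulr_sumr mulr_gt0.
by rewrite !ffunE E1 /GRing.scale /= mulr_sumr; apply: eq_bigr => j _; rewrite mulrA.
Qed.

Lemma ville_alternative :
  (exists2 g : I -> R, (forall i, 0 <= g i) /\ (forall i, g i != 0 -> P i) &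
     forall j, Q j -> \sum_i g i * M i j < 0) \/
  (exists2 lam : J -> R,
     [/\ forall j, 0 <= lam j, forall j, lam j != 0 -> Q j & \sum_j lam j = 1] &
     forall i, P i -> 0 <= \sum_j lam j * M i j).
Proof.
have [[y y_ge0 y_lt0]|[u /pos_cone_columns[lam [lam_ge0 lamQ lam_gt0] lamE] u_ge0]] :=
  cone_alternative [seq column j | j <- enum Q] (enum_uniq P).
  left; exists (fun i => if P i then y i else 0).
    by split=> i; case: (P i); rewrite ?eqxx.
  move=> j Qj; have := y_lt0 (column j); rewrite map_f ?mem_enum // => /(_ isT).
  rewrite big_enum /= [in X in X -> _]big_mkcond; congr (_ < 0); apply: eq_bigr => i _.
  by rewrite ffunE -[i \in _]/(P i); case: (P i); rewrite ?mul0r.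
right; set s := \sum_j lam j in lam_gt0; exists (fun j => lam j / s).
  split=> [j|j|]; first by rewrite divr_ge0 // ltW.
    by rewrite mulf_eq0 negb_or => /andP[/lamQ].
  by rewrite -mulr_suml divff ?gt_eqF.
move=> i Pi; under eq_bigr do rewrite mulrAC.
by rewrite -mulr_suml -lamE divr_ge0 ?(ltW lam_gt0) // u_ge0 // mem_enum.
Qed.

End Ville.

(** * Perturbations of a graph *)

Definition andrasfai_form (R : realFieldType) (n s : R) : R :=
  6 * n ^+ 2 - 32 * (n * s) + 44 * s ^+ 2.

Definition edge_weight (R : realFieldType) (T : finType) (e : rel T) (w : T -> R) : R :=
  \sum_x \sum_y (e x y)%:R * (w x * w y).

(* The weighted form of a bound on [ex_tf] by [andrasfai_form n s + G * n ^+ 2]. *)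
Definition weighted_ex_bound (R : realFieldType) (G : R) : Prop :=
  forall (T : finType) (e : rel T) (W : T -> R) (s : R),
    symmetric e -> triangle_free_rel e -> (forall x, 0 <= W x) ->
    (forall A, indep_set e A -> \sum_(x in A) W x <= s) ->
    4 * (\sum_x W x) <= 11 * s -> 8 * s <= 3 * (\sum_x W x) ->
    edge_weight e W <= 2 * (andrasfai_form (\sum_x W x) s + G * (\sum_x W x) ^+ 2).

Lemma edge_weight_decrease (R : realFieldType) (T : finType) (e : rel T) (s : R)
    (loss : T -> R) :
  symmetric e -> (forall x, 0 <= loss x) -> (forall x, \sum_y (e x y)%:R <= s) ->
  \sum_x \sum_y (e x y)%:R - 2 * s * (\sum_x loss x) <= edge_weight e (fun x => 1 - loss x).
Proof.
move=> esym loss_ge0 deg.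
have swap : \sum_x \sum_y (e x y)%:R * loss y = \sum_x loss x * \sum_y (e x y)%:R.
  rewrite exchange_big /=; apply: eq_bigr => y _; rewrite mulr_sumr.
  by apply: eq_bigr => x _; rewrite esym mulrC.
have -> : edge_weight e (fun x => 1 - loss x) =
    \sum_x \sum_y (e x y)%:R - 2 * (\sum_x loss x * \sum_y (e x y)%:R) + edge_weight e loss.
  rewrite mulrDl mul1r opprD -{2}swap addrA -!sumrB -big_split /=; apply: eq_bigr => x _.
  by rewrite mulr_sumr -!sumrB -big_split /=; apply: eq_bigr => y _; ring.
have : \sum_x loss x * \sum_y (e x y)%:R <= (\sum_x loss x) * s.
  by rewrite mulr_suml; apply: ler_sum => x _; apply: ler_wpM2l.
have : 0 <= edge_weight e loss by do 2!apply: sumr_ge0 => ? _; rewrite !mulr_ge0.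
lra.
Qed.

Section Perturbation.

Variables (R : realFieldType) (V : finType) (e : rel V) (added removed : {set V} -> R).

Definition loss (v : V) : R := \sum_(Y : {set V} | v \in Y) removed Y / #|Y|%:R.

(* Each independent set [B] becomes a new vertex of weight [added B] with neighborhood
   [B]; a total weight of [removed Y] is taken off uniformly from each set [Y]. *)
Definition perturbed_rel : rel (V + {set V}) := fun x y =>
  match x, y with
  | inl u, inl v => e u v
  | inl u, inr B => (u \in B) && indep_set e B
  | inr B, inl u => (u \in B) && indep_set e B
  | inr _, inr _ => false
  end.

Definition perturbed_weight (x : V + {set V}) : R :=
  match x with inl v => 1 - loss v | inr B => added B end.

Lemma perturbed_rel_sym : symmetric e -> symmetric perturbed_rel.
Proof. by move=> esym [u|B] [v|C] //=. Qed.

Lemma perturbed_rel_triangle_free : triangle_free_rel e -> triangle_free_rel perturbed_rel.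
Proof.
move=> etf [u|A] [v|B] [w|C] //=; first exact: etf.
- move=> uv /andP[vC indC]; rewrite indC andbT; apply: contraL uv => uC.
  exact: (indep_setP _ _ indC).
- by move=> /andP[uB /indep_setP indB] /andP[wB _]; apply: indB.
move=> /andP[vA indA] vw; rewrite indA andbT; apply: contraL vw => wA.
exact: (indep_setP _ _ indA).
Qed.

Hypotheses (removed_ge0 : forall Y, 0 <= removed Y) (removed0 : removed set0 = 0).

Lemma loss_ge0 (v : V) : 0 <= loss v.
Proof. by apply: sumr_ge0 => Y _; apply: divr_ge0. Qed.

Lemma sum_loss (A : {set V}) :
  \sum_(v in A) loss v = \sum_Y removed Y * (#|A :&: Y|%:R / #|Y|%:R).
Proof.
rewrite /loss (exchange_big_dep xpredT) //=; apply: eq_bigr => Y _.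
rewrite (eq_bigl (fun v => v \in A :&: Y)) => [|v]; last by rewrite inE.
by rewrite sumr_const -[_ *+ _]mulr_natr mulrAC mulrA.
Qed.

Lemma sum_lossT : \sum_v loss v = \sum_Y removed Y.
Proof.
rewrite (eq_bigl (fun v => v \in [set: V])) => [|v]; last by rewrite inE.
rewrite sum_loss; apply: eq_bigr => Y _; rewrite setTI.
have [->|Y_neq0] := eqVneq Y set0; first by rewrite removed0 mul0r.
by rewrite divff ?mulr1 // pnatr_eq0 cards_eq0.
Qed.

Hypotheses (added_ge0 : forall B, 0 <= added B).
Hypothesis added_indep : forall B, added B != 0 -> indep_set e B.

Lemma perturbed_edge_weightE : edge_weight perturbed_rel perturbed_weight =
  edge_weight e (fun v => 1 - loss v) + 2 * (\sum_B added B * (\sum_(v in B) (1 - loss v))).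
Proof.
have mixed : \sum_u \sum_B (perturbed_rel (inl u) (inr B))%:R * ((1 - loss u) * added B) =
    \sum_B added B * (\sum_(v in B) (1 - loss v)).
  rewrite exchange_big /=; apply: eq_bigr => B _.
  have [->|/added_indep ->] := eqVneq (added B) 0.
    by rewrite mul0r big1 // => u _; rewrite !mulr0.
  rewrite mulr_sumr [RHS]big_mkcond; apply: eq_bigr => u _.
  by rewrite andbT; case: (u \in B); rewrite ?mul1r ?mul0r // mulrC.
rewrite -mixed /edge_weight big_sumType /=; under eq_bigr do rewrite big_sumType /=.
rewrite big_split /= -addrA mulrDl mul1r; congr (_ + (_ + _)).
rewrite [RHS]exchange_big /=; apply: eq_bigr => B _; rewrite big_sumType /=.
rewrite [X in _ + X]big1 ?addr0 => [|C _]; last by rewrite mul0r.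
by apply: eq_bigr => u _; rewrite [added B * _]mulrC.
Qed.

Lemma perturbed_edge_weight_ge (s : R) :
  symmetric e -> (forall u, \sum_v (e u v)%:R <= s) ->
  \sum_u \sum_v (e u v)%:R - 2 * s * (\sum_Y removed Y) + 2 * (\sum_B added B * #|B|%:R) -
    2 * (\sum_B added B) * (\sum_Y removed Y) <= edge_weight perturbed_rel perturbed_weight.
Proof.
move=> esym deg; rewrite perturbed_edge_weightE.
have := edge_weight_decrease esym loss_ge0 deg; rewrite sum_lossT.
have -> : \sum_B added B * (\sum_(v in B) (1 - loss v)) =
    \sum_B added B * #|B|%:R - \sum_B added B * (\sum_(v in B) loss v).
  by rewrite -sumrB; apply: eq_bigr => B _; rewrite sumrB sumr_const mulrBr.
have : \sum_B added B * (\sum_(v in B) loss v) <= (\sum_B added B) * (\sum_Y removed Y).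
  rewrite mulr_suml; apply: ler_sum => B _; apply: ler_wpM2l => //.
  by rewrite -sum_lossT; apply: ler_psum_sub => //; apply: loss_ge0.
lra.
Qed.

Lemma perturbed_indep_weight (s : R) :
  (forall I, indep_set e I ->
     #|I|%:R - \sum_Y removed Y * (#|I :&: Y|%:R / #|Y|%:R) +
       \sum_(B : {set V} | [disjoint B & I]) added B <= s) ->
  forall A, indep_set perturbed_rel A -> \sum_(x in A) perturbed_weight x <= s.
Proof.
move=> alpha A /indep_setP indA; pose I := [set v | inl v \in A].
have indI : indep_set e I.
  by apply/indep_setP => u v; rewrite !inE => uA vA; apply: (indA (inl u) (inl v)).
apply: le_trans (alpha I indI); rewrite big_mkcond big_sumType /= -!big_mkcond /=.
apply: lerD.
  rewrite -sum_loss -sum1_card natr_sum -sumrB.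
  by rewrite (eq_bigl (fun v => v \in I)) // => v; rewrite inE.
rewrite [leLHS]big_mkcond [leRHS]big_mkcond; apply: ler_sum => B _.
case: ifP => BA; last by case: ifP.
have [->|/added_indep indB] := eqVneq (added B) 0; first by rewrite if_same.
rewrite ifT //; apply/pred0P => v /=; apply/negP => /andP[vB]; rewrite inE => vA.
by have := indA (inl v) (inr B) vA BA; rewrite /= vB indB.
Qed.

Lemma perturbation_bound (G s s' : R) :
  weighted_ex_bound G -> symmetric e -> triangle_free_rel e ->
  (forall u, \sum_v (e u v)%:R <= s) -> (forall v, loss v <= 1) ->
  (forall I, indep_set e I ->
     #|I|%:R - \sum_Y removed Y * (#|I :&: Y|%:R / #|Y|%:R) +
       \sum_(B : {set V} | [disjoint B & I]) added B <= s') ->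
  let g := \sum_B added B in let q := \sum_Y removed Y in let n' := #|V|%:R - q + g in
  4 * n' <= 11 * s' -> 8 * s' <= 3 * n' ->
  \sum_u \sum_v (e u v)%:R - 2 * s * q + 2 * (\sum_B added B * #|B|%:R) - 2 * g * q <=
  2 * (andrasfai_form n' s' + G * n' ^+ 2).
Proof.
move=> bound esym etf deg loss_le1 alpha g q n' lo hi.
apply: le_trans (perturbed_edge_weight_ge esym deg) _.
have nE : \sum_x perturbed_weight x = n'.
  by rewrite big_sumType /= sumrB sum_lossT sumr_const.
rewrite -nE; apply: bound; rewrite ?nE //.
- exact: perturbed_rel_sym.
- exact: perturbed_rel_triangle_free.
- by case=> [v|B] //=; rewrite subr_ge0.
exact: perturbed_indep_weight.
Qed.

End Perturbation.

(** * Near-extremal graphs *)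

Section Prices.

Variables (R : realFieldType) (F n s : R).

(* The partial derivatives of [andrasfai_form n s + F * n ^+ 2]. *)
Definition vertex_price : R := 12 * n - 32 * s + 2 * F * n.
Definition indep_price : R := 8 * (11 * s - 4 * n).

Definition avoid_rate : R := (s - vertex_price) / indep_price.

Lemma andrasfai_form_taylor_le (tau x y z : R) :
  `|x| <= z -> `|y| <= z -> z <= n -> 0 <= F <= 1 -> 0 <= tau ->
  andrasfai_form (n + x) (s + y) + (F + tau) * (n + x) ^+ 2 <=
  andrasfai_form n s + F * n ^+ 2 + vertex_price * x + indep_price * y +
    83 * z ^+ 2 + 4 * tau * n ^+ 2.
Proof.
move=> x_le y_le z_le /andP[F_ge0 F_le1] tau_ge0.
have z_ge0 : 0 <= z by apply: le_trans x_le.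
have x2 : x ^+ 2 <= z ^+ 2 by rewrite -real_normK ?num_real // lerXn2r ?nnegrE.
have y2 : y ^+ 2 <= z ^+ 2 by rewrite -real_normK ?num_real // lerXn2r ?nnegrE.
have xy : - (x * y) <= z ^+ 2.
  by have := sqr_ge0 (x + y); move: x2 y2; rewrite !expr2; lra.
have Fx2 : F * x ^+ 2 <= z ^+ 2 by apply: le_trans x2; rewrite ler_piMl ?sqr_ge0.
have tau_nx : tau * (n + x) ^+ 2 <= tau * (n + n) ^+ 2.
  move: x_le; rewrite ler_norml => /andP[x_ge x_le].
  by apply: ler_wpM2l => //; rewrite lerXn2r ?nnegrE //; lra.
rewrite /andrasfai_form /vertex_price /indep_price.
move: x2 y2 xy Fx2 tau_nx; rewrite !expr2; lra.
Qed.

Hypotheses (n_gt0 : 0 < n) (lo : 4 * n <= 11 * s) (hi : 8 * s <= 3 * n).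
Hypothesis degree_le : 2 * (andrasfai_form n s + F * n ^+ 2) <= n * s.

Lemma excess_factor_le : 2 * F * n * n <= (3 * n - 8 * s) * (11 * s - 4 * n).
Proof. by move: degree_le; rewrite /andrasfai_form !expr2; lra. Qed.

Lemma range_lo_gap : 22 * F * n <= 11 * s - 4 * n.
Proof.
rewrite -(ler_pM2r n_gt0); have := excess_factor_le; have lo' := lo; have hi' := hi.
have : (3 * n - 8 * s) * (11 * s - 4 * n) <= n / 11 * (11 * s - 4 * n).
  by rewrite ler_wpM2r //; lra.
lra.
Qed.

Lemma range_hi_gap : 16 * F * n <= 3 * n - 8 * s.
Proof.
rewrite -(ler_pM2r n_gt0); have := excess_factor_le; have lo' := lo; have hi' := hi.
have : (3 * n - 8 * s) * (11 * s - 4 * n) <= (3 * n - 8 * s) * (n / 8).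
  by rewrite ler_wpM2l //; lra.
lra.
Qed.

Lemma excess_le : F <= 1 / 352.
Proof. by rewrite -(ler_pM2r n_gt0); have := range_lo_gap; have := range_hi_gap; lra. Qed.

Hypothesis F_gt0 : 0 < F.

Lemma indep_price_gt0 : 0 < indep_price.
Proof.
by have := range_lo_gap; have := mulr_gt0 F_gt0 n_gt0; rewrite /indep_price; lra.
Qed.

Lemma avoid_rateM : avoid_rate * indep_price = s - vertex_price.
Proof. by rewrite /avoid_rate divfK ?gt_eqF ?indep_price_gt0. Qed.

Lemma avoid_rate_ge : 4 / 11 <= avoid_rate.
Proof.
rewrite -(ler_pM2r indep_price_gt0) avoid_rateM /indep_price /vertex_price.
by have := range_lo_gap; lra.
Qed.

Lemma avoid_rate_le : avoid_rate <= 3 / 8 - 2 * F.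
Proof.
rewrite -(ler_pM2r indep_price_gt0) avoid_rateM /indep_price /vertex_price.
have : F * (11 * s - 4 * n) <= F * (n / 8) by rewrite ler_pM2l //; have := hi; lra.
lra.
Qed.

End Prices.

Section ExcessSlack.

Variables (R : realFieldType) (f : R).

Definition move_size : R := size_tolerance f ^+ 2.

(* The excess by which a near-extremal graph may fall short of the supremum. *)
Definition excess_slack : R := core_tolerance f * move_size.

Hypothesis f_gt0 : 0 < f.

Lemma move_size_gt0 : 0 < move_size.
Proof. by rewrite exprn_gt0 ?size_tolerance_gt0. Qed.

Lemma excess_slack_gt0 : 0 < excess_slack.
Proof. by rewrite mulr_gt0 ?move_size_gt0 ?core_tolerance_gt0. Qed.

Hypothesis f_le : f <= 1 / 176.

Lemma move_size_le_core_tolerance : move_size <= core_tolerance f.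
Proof.
have b_gt0 := size_tolerance_gt0 f_gt0; apply: (@le_trans _ _ (size_tolerance f)).
  rewrite /move_size expr2 ler_piMl ?ltW //.
  have := size_tolerance_le_slack f_gt0 f_le; have := f_le; lra.
by have := size_tolerance_le f_gt0 f_le; have := core_tolerance_gt0 f_gt0; lra.
Qed.

Lemma move_size_le_slack : move_size <= f / 100.
Proof. exact: le_trans move_size_le_core_tolerance (core_tolerance_le_slack f_gt0 f_le). Qed.

(* The first-order gain of a profitable move exceeds the second-order terms. *)
Lemma second_order_small (n L : R) : 0 < n -> 176 * f * n <= L ->
  (84 * move_size ^+ 2 + 4 * excess_slack) * n ^+ 2 < L * (tolerance f * (move_size * n)).
Proof.
move=> n_gt0 L_ge; have eta_gt0 := tolerance_gt0 f_gt0; have z_gt0 := move_size_gt0.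
apply: (@lt_le_trans _ _ (176 * f * n * (tolerance f * (move_size * n)))); last first.
  by rewrite ler_pM2r // mulr_gt0 // mulr_gt0.
have -> : 176 * f * n * (tolerance f * (move_size * n)) = 176 * excess_slack * n ^+ 2.
  by rewrite /excess_slack /core_tolerance; ring.
rewrite ltr_pM2r ?exprn_gt0 //; have := excess_slack_gt0.
have : move_size ^+ 2 <= excess_slack.
  rewrite expr2; apply: ler_wpM2r; [exact: ltW | exact: move_size_le_core_tolerance].
lra.
Qed.

End ExcessSlack.

Section NearExtremal.

Variables (R : realFieldType) (V : finType) (e : rel V) (s : nat) (F f : R).

Local Notation n := (#|V|%:R : R).
Local Notation eta := (tolerance f).
Local Notation b := (size_tolerance f).
Local Notation z := (move_size f * n).
Local Notation mu := (vertex_price F n s%:R).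
Local Notation L := (indep_price n s%:R).
Local Notation rho := (avoid_rate F n s%:R).

Hypotheses (esym : symmetric e) (etf : triangle_free_rel e) (alpha : indep_le e s).
Hypotheses (n_gt0 : 0 < n) (lo : 4 * n <= 11 * s%:R) (hi : 8 * s%:R <= 3 * n).
Hypothesis edges : \sum_u \sum_v (e u v)%:R = 2 * (andrasfai_form n s%:R + F * n ^+ 2).
Hypothesis bound : weighted_ex_bound (F + excess_slack f).
Hypotheses (f_gt0 : 0 < f) (f_le_F : f <= F).

Definition size_penalty (I : {set V}) : R := (s%:R - #|I|%:R) / z.

(* The moves add a vertex with neighborhood [B], or remove a vertex at random from [Y]. Up
   to a small tolerance, the payoff of a move is the resulting growth of the independent
   set [I], less the growth of the bound [s] that pays for the change of the number of
   edges. *)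
Definition move_payoff (i : {set V} + {set V}) (I : {set V}) : R :=
  match i with
  | inl B => [disjoint B & I]%:R - (#|B|%:R - mu) / L + eta - size_penalty I
  | inr Y => - (#|I :&: Y|%:R / #|Y|%:R) + rho + eta - size_penalty I
  end.

Definition legal_move (i : {set V} + {set V}) : bool :=
  match i with
  | inl B => large_indep e s (b * n) B
  | inr Y => f * n <= #|Y|%:R
  end.

Let F_gt0 : 0 < F.
Proof. exact: lt_le_trans f_le_F. Qed.

Let degree_le (u : V) : \sum_v (e u v)%:R <= s%:R :> R.
Proof. by rewrite -natr_sum ler_nat triangle_free_degree_le. Qed.

Lemma edge_count_le : 2 * (andrasfai_form n s%:R + F * n ^+ 2) <= n * s%:R.
Proof.
by rewrite -edges mulr_natl -[#|V|]/(#|xpredT|) -sumr_const; apply: ler_sum.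
Qed.

Let F_le : F <= 1 / 352.
Proof. exact: excess_le n_gt0 lo hi edge_count_le. Qed.

Let f_le : f <= 1 / 176.
Proof. by have := f_le_F; have := F_le; lra. Qed.

Let fn_gt0 : 0 < f * n.
Proof. exact: mulr_gt0. Qed.

Let fn_le_Fn : f * n <= F * n.
Proof. by rewrite ler_pM2r. Qed.

Let z_gt0 : 0 < z.
Proof. by rewrite mulr_gt0 ?move_size_gt0. Qed.

Let L_gt0 : 0 < L.
Proof. exact: indep_price_gt0 n_gt0 lo hi edge_count_le F_gt0. Qed.

Lemma indep_price_ge : 176 * f * n <= L.
Proof.
by have := range_lo_gap n_gt0 lo hi edge_count_le; have := fn_le_Fn; rewrite /indep_price; lra.
Qed.

Lemma size_tolerance_le_price : b * n <= eta * L.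
Proof.
have eta_gt0 := tolerance_gt0 f_gt0.
have -> : b * n = eta * (f * (f * n)) by rewrite /size_tolerance /core_tolerance; ring.
rewrite ler_pM2l //; apply: le_trans indep_price_ge.
have : f * (f * n) <= 1 * (f * n) by rewrite ler_pM2r //; have := f_le; lra.
by have := fn_gt0; lra.
Qed.

Let rhoM : rho * L = s%:R - mu.
Proof. exact: avoid_rateM n_gt0 lo hi edge_count_le F_gt0. Qed.

Let rho_ge : 4 / 11 <= rho.
Proof. exact: avoid_rate_ge n_gt0 lo hi edge_count_le F_gt0. Qed.

Let rho_le : rho <= 3 / 8 - 2 * F.
Proof. exact: avoid_rate_le n_gt0 lo hi edge_count_le F_gt0. Qed.

Let eta_le : eta <= 1 / 1000.
Proof. by have := f_le; rewrite /tolerance; lra. Qed.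

Lemma large_value_ge (B : {set V}) : large_indep e s (b * n) B ->
  rho - eta <= (#|B|%:R - mu) / L.
Proof.
case/andP => _ B_ge; rewrite ler_pdivlMr // mulrBl rhoM.
by have := size_tolerance_le_price; move: B_ge; lra.
Qed.

Section MixedStrategy.

Variable lam : {set V} -> R.
Hypothesis lam_distr : indep_distribution e lam.
Hypothesis lam_payoff : forall i, legal_move i -> 0 <= \sum_I lam I * move_payoff i I.

Definition mean_penalty : R := \sum_I lam I * size_penalty I.

Lemma mean_deficit : \sum_I lam I * (s%:R - #|I|%:R) = mean_penalty * z.
Proof.
rewrite /mean_penalty mulr_suml; apply: eq_bigr => I _.
by rewrite /size_penalty -mulrA divfK ?gt_eqF.
Qed.

Lemma mean_penalty_ge0 : 0 <= mean_penalty.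
Proof.
have [lam_ge0 lam_indep _] := lam_distr; apply: sumr_ge0 => I _.
have [->|/lam_indep/alpha I_le] := eqVneq (lam I) 0; first by rewrite mul0r.
by rewrite mulr_ge0 // divr_ge0 ?(ltW z_gt0) // subr_ge0 ler_nat.
Qed.

Lemma mean_payoff_add (B : {set V}) : \sum_I lam I * move_payoff (inl B) I =
  \sum_(I : {set V} | [disjoint B & I]) lam I - (#|B|%:R - mu) / L + eta - mean_penalty.
Proof.
have [_ _ lam1] := lam_distr; under eq_bigr do rewrite 3!mulrDr 2!mulrN.
rewrite 3!big_split /= 2!sumrN -!mulr_suml lam1 !mul1r; congr (_ - _ + _ - _).
by rewrite [RHS]big_mkcond; apply: eq_bigr => I _; case: ifP; rewrite ?mulr1 ?mulr0.
Qed.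

Lemma mean_payoff_remove (Y : {set V}) : \sum_I lam I * move_payoff (inr Y) I =
  - ((\sum_I lam I * #|I :&: Y|%:R) / #|Y|%:R) + rho + eta - mean_penalty.
Proof.
have [_ _ lam1] := lam_distr; under eq_bigr do rewrite 3!mulrDr 2!mulrN.
rewrite 3!big_split /= 2!sumrN -!mulr_suml lam1 !mul1r; congr (- _ + _ + _ - _).
by rewrite mulr_suml; apply: eq_bigr => I _; rewrite mulrA.
Qed.

Lemma balanced_of_payoff : balanced_distribution e s rho f lam.
Proof.
have P_ge0 := mean_penalty_ge0; have [lam_ge0 _ _] := lam_distr.
have hit (Y : {set V}) : f * n <= #|Y|%:R ->
    \sum_I lam I * #|I :&: Y|%:R <= (rho + eta - mean_penalty) * #|Y|%:R.
  move=> Y_ge; have Y_gt0 : 0 < #|Y|%:R :> R by apply: lt_le_trans Y_ge.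
  have := lam_payoff (i := inr Y) Y_ge; rewrite mean_payoff_remove -ler_pdivrMr //; lra.
split=> // [|B B_large|Y Y_ge].
- rewrite mean_deficit ler_piMl ?(ltW z_gt0) //.
  have := hit [set: V]; rewrite cardsT => /(_ ltac:(have := f_le; have := n_gt0; nra)).
  have : 0 <= \sum_I lam I * #|I :&: [set: V]|%:R by apply: sumr_ge0 => I _; apply: mulr_ge0.
  move=> /le_trans le_hit /le_hit; rewrite (pmulr_lge0 _ n_gt0) subr_ge0.
  by move=> /le_trans; apply; have := rho_le; have := eta_le; have := F_gt0; lra.
- have := lam_payoff (i := inl B) B_large; rewrite mean_payoff_add.
  by have := large_value_ge B_large; lra.
apply: le_trans (hit Y Y_ge) _; apply: ler_wpM2r => //; lra.
Qed.

End MixedStrategy.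

Section ProfitableMove.

Variables added removed : {set V} -> R.
Hypotheses (added_ge0 : forall B, 0 <= added B) (removed_ge0 : forall Y, 0 <= removed Y).
Hypothesis added_legal : forall B, added B != 0 -> legal_move (inl B).
Hypothesis removed_legal : forall Y, removed Y != 0 -> legal_move (inr Y).
Hypothesis total : \sum_B added B + \sum_Y removed Y = z.

Local Notation g := (\sum_B added B).
Local Notation q := (\sum_Y removed Y).

Definition move_value : R := \sum_B added B * ((#|B|%:R - mu) / L).

Definition bound_shift : R := move_value - q * rho - eta * z.

Let g_ge0 : 0 <= g. Proof. exact: sumr_ge0. Qed.
Let q_ge0 : 0 <= q. Proof. exact: sumr_ge0. Qed.

Lemma move_valueM : move_value * L = \sum_B added B * #|B|%:R - mu * g.
Proof.
rewrite mulr_suml mulr_sumr -sumrB; apply: eq_bigr => B _.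
by rewrite -mulrA divfK ?gt_eqF // mulrBr [mu * _]mulrC.
Qed.

Lemma move_value_bounds : 0 <= move_value <= g * rho.
Proof.
rewrite mulr_suml; apply/andP; split; [apply: sumr_ge0 | apply: ler_sum] => B _.
  have [->|/added_legal/large_value_ge B_ge] := eqVneq (added B) 0; first by rewrite mul0r.
  by apply: mulr_ge0 => //; move: B_ge; have := rho_ge; have := eta_le; lra.
have [->|/added_legal/andP[indB _]] := eqVneq (added B) 0; first by rewrite !mul0r.
by apply: ler_wpM2l => //; rewrite ler_pM2r ?invr_gt0 // lerD2r ler_nat alpha.
Qed.

Definition total_payoff (I : {set V}) : R :=
  \sum_B added B * move_payoff (inl B) I + \sum_Y removed Y * move_payoff (inr Y) I.

Lemma move_indep_le (I : {set V}) : total_payoff I <= 0 ->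
  #|I|%:R - \sum_Y removed Y * (#|I :&: Y|%:R / #|Y|%:R) +
    \sum_(B : {set V} | [disjoint B & I]) added B <= s%:R + bound_shift.
Proof.
rewrite /total_payoff; under eq_bigr do rewrite 3!mulrDr 2!mulrN.
under [X in _ + X <= _]eq_bigr do rewrite 3!mulrDr 2!mulrN.
rewrite 6!big_split /= 4!sumrN -!mulr_suml -/move_value.
have -> : \sum_B added B * [disjoint B & I]%:R = \sum_(B : {set V} | [disjoint B & I]) added B.
  by rewrite [RHS]big_mkcond; apply: eq_bigr => B _; case: ifP; rewrite ?mulr1 ?mulr0.
have : (g + q) * size_penalty I = s%:R - #|I|%:R.
  by rewrite total /size_penalty mulrC divfK ?gt_eqF.
rewrite /bound_shift -total.
by move: (\sum_(B : {set V} | _) _) (\sum_Y removed Y * _) => p p'; lra.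
Qed.

Lemma removed_set0 : removed set0 = 0.
Proof.
apply/eqP; apply: contraT => /removed_legal /=; rewrite cards0.
by have := fn_gt0; lra.
Qed.

Lemma move_loss_le1 (v : V) : loss removed v <= 1.
Proof.
apply: le_trans (_ : \sum_Y removed Y / (f * n) <= _).
  rewrite /loss big_mkcond; apply: ler_sum => Y _; case: ifP => _; last first.
    by rewrite divr_ge0 // ltW.
  have [->|/removed_legal Y_ge] := eqVneq (removed Y) 0; first by rewrite !mul0r.
  by apply: ler_wpM2l => //; rewrite lef_pV2 // posrE; apply: lt_le_trans Y_ge.
rewrite -mulr_suml ler_pdivrMr // mul1r.
have : z <= f / 100 * n by rewrite ler_pM2r // move_size_le_slack ?f_le.
by have := total; have := g_ge0; have := fn_gt0; lra.
Qed.

Lemma bound_shift_norm_le : `|bound_shift| <= z.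
Proof.
have /andP[value_ge0 value_le] := move_value_bounds; have z0 := z_gt0.
have : g * rho <= g * 1 by apply: ler_wpM2l => //; have := rho_le; have := F_gt0; lra.
have : q * rho <= q * (1 - eta).
  by apply: ler_wpM2l => //; have := rho_le; have := F_gt0; have := eta_le; lra.
have : 0 <= q * rho by rewrite mulr_ge0 //; have := rho_ge; lra.
have : eta * g <= 1 * g by apply: ler_wpM2r => //; have := eta_le; lra.
have : 0 <= eta * z by rewrite mulr_ge0 // ltW ?tolerance_gt0.
rewrite ler_norml /bound_shift -total.
move: value_ge0 value_le g_ge0 q_ge0; move: g q move_value rho eta => *.
by apply/andP; split; lra.
Qed.

(* The weight of the perturbed graph is compared with the second order expansion of
   [andrasfai_form] at [(n + (g - q), s + bound_shift)]. *)
Lemma second_order_bound : (forall I, indep_set e I -> total_payoff I <= 0) ->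
  L * (eta * z) <= 84 * z ^+ 2 + 4 * excess_slack f * n ^+ 2.
Proof.
move=> payoff_le0; have /[dup] shift_le := bound_shift_norm_le.
rewrite ler_norml => /andP[shift_ge shift_le'].
have gq_le : `|g - q| <= z by rewrite ler_norml -total; have := g_ge0; have := q_ge0; lra.
have /andP[gq_ge gq_le'] : - z <= g - q <= z by rewrite -ler_norml.
have z_le : z <= f / 100 * n by rewrite ler_pM2r // move_size_le_slack ?f_le.
have z_le_n : z <= n by have := f_le; have := n_gt0; nra.
have gap_lo := range_lo_gap n_gt0 lo hi edge_count_le.
have gap_hi := range_hi_gap n_gt0 lo hi edge_count_le.
have fn0 := fn_gt0; have fnFn := fn_le_Fn.
have := perturbation_bound removed_ge0 removed_set0 added_ge0
  (fun B cB => proj1 (andP (added_legal cB))) bound esym etf degree_le move_loss_le1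
  (fun I indI => move_indep_le (payoff_le0 I indI)).
rewrite /= edges (_ : n - q + g = n + (g - q)); last by ring.
move=> /(_ ltac:(lra) ltac:(lra)).
have slack_ge0 := ltW (excess_slack_gt0 f_gt0).
have F01 : 0 <= F <= 1 by have := F_gt0; have := F_le; lra.
have := andrasfai_form_taylor_le s%:R gq_le shift_le z_le_n F01 slack_ge0.
have : g * q <= z ^+ 2.
  by rewrite expr2; apply: ler_pM => //; have := total; have := g_ge0; have := q_ge0; lra.
have : L * bound_shift = \sum_B added B * #|B|%:R - mu * g - q * (s%:R - mu) - L * (eta * z).
  by rewrite -rhoM -move_valueM /bound_shift; ring.
move: (\sum_B added B * _) (andrasfai_form _ _) (andrasfai_form _ _) => m form' form.
lra.
Qed.

Lemma exists_positive_payoff : exists2 I, indep_set e I & 0 < total_payoff I.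
Proof.
apply/exists_inP; apply: contraT => /exists_inPn no_payoff.
have := second_order_small f_gt0 f_le n_gt0 indep_price_ge.
have payoff_le0 (I : {set V}) : indep_set e I -> total_payoff I <= 0.
  by move=> indI; rewrite leNgt no_payoff.
by have := second_order_bound payoff_le0; rewrite mulrDl exprMn mulrA; lra.
Qed.

End ProfitableMove.

Lemma exists_balanced_distribution : exists lam, balanced_distribution e s rho f lam.
Proof.
have [[w [w_ge0 w_legal] w_lt0]|[lam lam_distr lam_payoff]] :=
  ville_alternative legal_move (indep_set e) (fun i I => move_payoff i I); last first.
  by exists lam; apply: balanced_of_payoff.
exfalso; have t_gt0 : 0 < \sum_i w i.
  rewrite lt0r sumr_ge0 // andbT; apply/negP => /eqP w0; have := w_lt0 _ (indep_set0 e).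
  by rewrite big1 ?ltxx // => i _; rewrite (psumr_eq0P (fun i _ => w_ge0 i) w0) ?mul0r.
pose k := z / \sum_i w i; have k_gt0 : 0 < k by rewrite divr_gt0.
have kwP i : k * w i != 0 -> legal_move i by rewrite mulf_eq0 negb_or => /andP[_ /w_legal].
have kw_ge0 i : 0 <= k * w i by apply: mulr_ge0 (ltW k_gt0) (w_ge0 i).
have [] := @exists_positive_payoff (fun B => k * w (inl B)) (fun Y => k * w (inr Y)).
- by move=> B.
- by move=> Y.
- by move=> B /kwP.
- by move=> Y /kwP.
- have sumE : \sum_B w (inl B) + \sum_Y w (inr Y) = \sum_i w i by rewrite big_sumType.
  by rewrite -!mulr_sumr -mulrDr sumE divfK // gt_eqF.
move=> I /w_lt0; rewrite big_sumType => /ltW payoff_le0.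
rewrite ltNge => /negP[]; rewrite /total_payoff.
under eq_bigr do rewrite -mulrA; under [X in _ + X <= _]eq_bigr do rewrite -mulrA.
by rewrite -!mulr_sumr -mulrDr pmulr_rle0.
Qed.

End NearExtremal.

Lemma near_extremal_excess_lt (R : realFieldType) (V : finType) (e : rel V) (s : nat) (F f : R) :
  let n : R := #|V|%:R in
  symmetric e -> triangle_free_rel e -> indep_le e s ->
  0 < n -> 4 * n <= 11 * s%:R -> 8 * s%:R <= 3 * n ->
  \sum_u \sum_v (e u v)%:R = 2 * (andrasfai_form n s%:R + F * n ^+ 2) ->
  weighted_ex_bound (F + excess_slack f) -> 0 < f -> F < f.
Proof.
move=> n esym etf alpha n_gt0 lo hi edges bound f_gt0; rewrite ltNge; apply/negP => f_le_F.
have F_gt0 : 0 < F by apply: lt_le_trans f_le_F.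
have degree_le := edge_count_le esym etf alpha edges.
have [lam balanced] := exists_balanced_distribution esym etf alpha n_gt0 lo hi edges bound
  f_gt0 f_le_F.
have rho_ge := avoid_rate_ge n_gt0 lo hi degree_le F_gt0.
have rho_le := avoid_rate_le n_gt0 lo hi degree_le F_gt0.
have fn_le : f * n <= F * n by rewrite ler_pM2r.
have gap_lo : 22 * f * n <= 11 * s%:R - 4 * n.
  by have := range_lo_gap n_gt0 lo hi degree_le; lra.
have gap_hi : 16 * f * n <= 3 * n - 8 * s%:R.
  by have := range_hi_gap n_gt0 lo hi degree_le; lra.
have := balanced_distribution_rho_gt esym alpha n_gt0 f_gt0 gap_lo gap_hi rho_ge balanced.
by lra.
Qed.

(** * The upper bound *)

Definition ex_bound (G : rat) : Prop :=
  forall n s : nat, (4 * n <= 11 * s)%N -> (8 * s <= 3 * n)%N ->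
    (ex_tf n s)%:R <= andrasfai_form n%:R s%:R + G * n%:R ^+ 2.

Lemma common_denominator (T : finType) (W : T -> rat) : (forall t, 0 <= W t) ->
  exists (d : nat) (w : T -> nat), (0 < d)%N /\ forall t, (w t)%:R = d%:R * W t.
Proof.
move=> W_ge0; pose q t := `|denq (W t)|%N; exists (\prod_t q t)%N.
exists (fun t => `|numq (W t)| * \prod_(u | u != t) q u)%N; split=> [|t].
  by rewrite prodn_gt0 // => t; rewrite /q absz_gt0 denq_neq0.
have -> : (\prod_t q t = q t * \prod_(u | u != t) q u)%N by rewrite (bigD1 t).
rewrite !natrM mulrAC; congr (_ * _).
have numE : (`|numq (W t)|%N)%:R = (numq (W t))%:~R :> rat.
  by rewrite -[in RHS](@gez0_abs (numq (W t))) // numq_ge0.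
have denE : (q t)%:R = (denq (W t))%:~R :> rat.
  by rewrite -[in RHS](@gez0_abs (denq (W t))) // ltW // denq_gt0.
by rewrite numE denE -[X in _ * X]divq_num_den mulrCA divff ?mulr1 // intr_eq0 denq_neq0.
Qed.

Lemma ex_bound_weighted (G : rat) : ex_bound G -> weighted_ex_bound G.
Proof.
move=> bound T e W s esym etf W_ge0 alpha; set n := \sum_x W x => lo hi.
have s_ge0 : 0 <= s by have := alpha _ (indep_set0 e); rewrite big_set0.
have [|d [w [d_gt0 wE]]] := common_denominator (W := fun t => if t is Some x then W x else s).
  by case.
have dR_gt0 : 0 < d%:R :> rat by rewrite ltr0n.
pose v x := w (Some x).
have vE x : (v x)%:R = d%:R * W x := wE (Some x).
have sE : (w None)%:R = d%:R * s := wE None.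
have nE : (\sum_x v x)%N%:R = d%:R * n.
  by rewrite natr_sum mulr_sumr; apply: eq_bigr => x _.
have lo' : (4 * (\sum_x v x) <= 11 * w None)%N.
  by rewrite -(ler_nat rat) !natrM nE sE ![_ * (d%:R * _)]mulrCA ler_pM2l.
have hi' : (8 * w None <= 3 * (\sum_x v x))%N.
  by rewrite -(ler_nat rat) !natrM nE sE ![_ * (d%:R * _)]mulrCA ler_pM2l.
have alpha' A : indep_set e A -> (\sum_(x in A) v x <= w None)%N.
  move=> /alpha; rewrite -(ler_nat rat) natr_sum sE.
  by under eq_bigr do rewrite vE; rewrite -mulr_sumr ler_pM2l.
have := blowup_le_ex_tf esym etf alpha'; have := bound _ _ lo' hi'.
rewrite nE sE -(ler_nat rat) natrM natr_sum => ex_le edges_le.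
rewrite -(ler_pM2l (exprn_gt0 2 dR_gt0)).
have -> : d%:R ^+ 2 * edge_weight e W = \sum_x (\sum_y e x y * (v x * v y))%N%:R.
  rewrite mulr_sumr; apply: eq_bigr => x _; rewrite mulr_sumr natr_sum; apply: eq_bigr => y _.
  by rewrite !natrM !vE; ring.
by apply: le_trans edges_le _; move: ex_le; rewrite /andrasfai_form; lra.
Qed.

Lemma andrasfai_form_ge0 (R : realFieldType) (n s : R) :
  4 * n <= 11 * s -> 8 * s <= 3 * n -> 0 <= andrasfai_form n s.
Proof.
move=> lo hi; have -> : andrasfai_form n s = 12 * (3 * s - n) ^+ 2 +
    8 * ((3 * s - n) * (3 * n - 8 * s)) + 2 * (3 * n - 8 * s) ^+ 2.
  by rewrite /andrasfai_form; ring.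
have x_ge0 : 0 <= 3 * s - n by lra.
have y_ge0 : 0 <= 3 * n - 8 * s by lra.
by rewrite !addr_ge0 ?mulr_ge0 ?sqr_ge0.
Qed.

(* A value of at least [c] could be increased by [tau] again and again. *)
Lemma lt_of_no_near_max (R : archiRealFieldType) (T : Type) (P : T -> Prop) (g : T -> R)
    (M c tau : R) :
  0 < tau -> (forall x, P x -> g x <= M) ->
  (forall x, P x -> c <= g x -> ~ (forall y, P y -> g y <= g x + tau)) ->
  forall x, P x -> g x < c.
Proof.
move=> tau_gt0 g_le no_near_max x Px; rewrite ltNge; apply/negP => gx_ge.
have [k] : exists k : nat, M - g x < k%:R * tau.
  exists (Num.bound (`|M - g x| / tau)); rewrite -ltr_pdivrMr //.
  apply: le_lt_trans (archi_boundP _); last by rewrite divr_ge0 // ltW.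
  by rewrite ler_pM2r ?invr_gt0 // ler_norm.
elim: k x Px gx_ge => [|k IH] x Px gx_ge gx_lt.
  by have := g_le x Px; rewrite mul0r in gx_lt; lra.
apply: (no_near_max x Px gx_ge) => y Py; rewrite leNgt; apply/negP => gy_gt.
apply: (IH y Py); first lra.
by move: gx_lt; rewrite -natr1 mulrDl mul1r; lra.
Qed.

Definition in_range (n s : nat) : bool := [&& 0 < n, 4 * n <= 11 * s & 8 * s <= 3 * n]%N.

Definition excess (n s : nat) : rat :=
  ((ex_tf n s)%:R - andrasfai_form n%:R s%:R) / n%:R ^+ 2.

Lemma in_rangeP (R : numDomainType) (n s : nat) : in_range n s ->
  [/\ 0 < n%:R :> R, 4 * n%:R <= 11 * s%:R :> R & 8 * s%:R <= 3 * n%:R :> R].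
Proof.
by case/and3P => n_gt0 lo hi; rewrite ltr0n; split=> //; rewrite -!natrM ler_nat.
Qed.

Lemma ex_tfE (n s : nat) : (0 < n)%N ->
  (ex_tf n s)%:R = andrasfai_form n%:R s%:R + excess n s * n%:R ^+ 2.
Proof.
move=> n_gt0; rewrite /excess divfK; first by rewrite addrC subrK.
by rewrite expf_neq0 // pnatr_eq0 -lt0n.
Qed.

Lemma excess_le_const (n s : nat) : in_range n s -> excess n s <= 1 / 352.
Proof.
move=> range; have [n_gt0 lo hi] := in_rangeP rat range.
apply: (excess_le n_gt0 lo hi); rewrite -ex_tfE; last by case/and3P: range.
by rewrite -!natrM ler_nat ex_tf_degree_bound.
Qed.

Lemma ex_bound_of_excess (G : rat) :
  (forall n s, in_range n s -> excess n s <= G) -> ex_bound G.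
Proof.
move=> excess_le_G [|n] s lo hi.
  have -> : s = 0%N by lia.
  have -> : ex_tf 0 0 = 0%N.
    by have := ex_tf_degree_bound 0 0; rewrite leqn0 muln_eq0 => /eqP.
  by rewrite /andrasfai_form expr0n !mulr0 subr0 !addr0.
rewrite ex_tfE // lerD2l ler_pM2r ?exprn_gt0 ?ltr0n // excess_le_G //.
by rewrite /in_range lo hi.
Qed.

Lemma no_near_extremal (f : rat) (n s : nat) : 0 < f -> in_range n s -> f <= excess n s ->
  ~ (forall n' s', in_range n' s' -> excess n' s' <= excess n s + excess_slack f).
Proof.
move=> f_gt0 range f_le excess_max; have [n_gt0 lo hi] := in_rangeP rat range.
have exE : (ex_tf n s)%:R = andrasfai_form n%:R s%:R + excess n s * n%:R ^+ 2.
  by apply: ex_tfE; case/and3P: range.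
have : (0 < ex_tf n s)%N.
  rewrite -(ltr_nat rat) exE ltr_wpDl ?andrasfai_form_ge0 // mulr_gt0 ?exprn_gt0 //.
  exact: lt_le_trans f_le.
case/ex_tf_attained => E /admissibleP[simpleE tfE alpha] cardE.
have := near_extremal_excess_lt (F := excess n s) (@adj_sym _ E) tfE alpha.
rewrite card_ord => /(_ f n_gt0 lo hi) lt_f.
suff : excess n s < f by rewrite ltNge f_le.
apply: lt_f => //; last exact/ex_bound_weighted/ex_bound_of_excess.
rewrite -exE -cardE -natrM -sum_adj // natr_sum.
by apply: eq_bigr => u _; rewrite natr_sum.
Qed.

Lemma excess_le0 (n s : nat) : in_range n s -> excess n s <= 0.
Proof.
move=> range; rewrite leNgt; apply/negP => f_gt0.
suff : excess n s < excess n s by rewrite ltxx.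
apply: (@lt_of_no_near_max rat (nat * nat) (fun p => in_range p.1 p.2)
  (fun p => excess p.1 p.2) (1 / 352) _ _ (excess_slack_gt0 f_gt0) _ _ (n, s) range).
  by move=> [n' s']; apply: excess_le_const.
move=> [n' s'] range' excess_ge near_max.
by apply: no_near_extremal f_gt0 range' excess_ge _ => n'' s''; apply: (near_max (n'', s'')).
Qed.

Lemma ex_tf_le (n s : nat) : (4 * n <= 11 * s)%N -> (8 * s <= 3 * n)%N ->
  (ex_tf n s)%:R <= andrasfai_form n%:R s%:R :> rat.
Proof.
move=> lo hi; have := ex_bound_of_excess excess_le0 lo hi.
by rewrite mul0r addr0.
Qed.

(** * The lower bound *)

Definition andrasfai_adj : rel nat := fun i j => (4 <= (i + 11 - j) %% 11 <= 7)%N.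

Definition andrasfai_rel : rel 'I_11 := fun i j => andrasfai_adj i j.

Lemma andrasfai_sym : symmetric andrasfai_rel.
Proof.
move=> i j; have := ltn_ord i; have := ltn_ord j.
by rewrite /andrasfai_rel /andrasfai_adj; lia.
Qed.

Lemma andrasfai_triangle_free : triangle_free_rel andrasfai_rel.
Proof.
move=> i j k; have := ltn_ord i; have := ltn_ord j; have := ltn_ord k.
by rewrite /andrasfai_rel /andrasfai_adj; lia.
Qed.

Definition light_class (i : nat) : bool := i \in [:: 0; 4; 8]%N.

Definition andrasfai_indep_pattern (b : bitseq) : bool :=
  all (fun i => all (fun j =>
    ~~ [&& nth false b i, nth false b j & andrasfai_adj i j]) (iota 0 11)) (iota 0 11).

Lemma andrasfai_indep_pattern_counts (b : bitseq) : size b = 11%N -> andrasfai_indep_pattern b ->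
  (count (nth false b) (iota 0 11) <= 4)%N /\
  (count (fun i => nth false b i && ~~ light_class i) (iota 0 11) <= 3)%N.
Proof.
have /allP counts : all (fun b => andrasfai_indep_pattern b ==>
    (count (nth false b) (iota 0 11) <= 4)%N &&
    (count (fun i => nth false b i && ~~ light_class i) (iota 0 11) <= 3)%N) (bitseqs 11).
  by vm_compute.
by move=> b11; have := mem_bitseqs b; rewrite b11 => /counts/implyP indb /indb/andP.
Qed.

Lemma andrasfai_indep_card (A : {set 'I_11}) : indep_set andrasfai_rel A ->
  (#|A| <= 4)%N /\ (#|[set i in A | ~~ light_class i]| <= 3)%N.
Proof.
move=> /indep_setP indA; pose b := mkseq (fun i => inord i \in A) 11.
have bE (i : 'I_11) : nth false b i = (i \in A) by rewrite nth_mkseq // inord_val.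
have cardE (B : {set 'I_11}) (P : pred nat) : (forall i : 'I_11, (i \in B) = P i) ->
    #|B| = count P (iota 0 11).
  move=> BP; rewrite -sum1_card -sum1_count -[iota 0 11]/(index_iota 0 11) big_mkord.
  exact: eq_bigl.
rewrite (cardE A (nth false b)) // (cardE _ (fun i => nth false b i && ~~ light_class i)).
  apply: andrasfai_indep_pattern_counts; first by rewrite size_mkseq.
  apply/allP => i; rewrite mem_iota => i11; apply/allP => j; rewrite mem_iota => j11.
  have := bE (Ordinal i11); have := bE (Ordinal j11) => /= -> ->.
  by apply/and3P => -[iA jA]; apply/negP; apply: (indA (Ordinal i11) (Ordinal j11)).
by move=> i; rewrite inE bE.
Qed.

Definition class_size (x y i : nat) : nat := if light_class i then y else x.

Lemma andrasfai_indep_weight (x y : nat) (A : {set 'I_11}) : (y <= x)%N ->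
  indep_set andrasfai_rel A -> (\sum_(i in A) class_size x y i <= 3 * x + y)%N.
Proof.
move=> yx /andrasfai_indep_card[A4 heavy3].
have -> : (\sum_(i in A) class_size x y i =
    (#|A| - #|[set i in A | ~~ light_class i]|) * y + #|[set i in A | ~~ light_class i]| * x)%N.
  have -> : (#|A| - #|[set i in A | ~~ light_class i]| = #|[set i in A | light_class i]|)%N.
    rewrite -(cardsID [set i : 'I_11 | ~~ light_class i] A) -setIdE addKn.
    by apply: eq_card => i; rewrite !inE negbK andbC.
  rewrite (bigID (fun i : 'I_11 => light_class i)) /= -!sum_nat_cond_const; congr (_ + _)%N.
    by apply: eq_bigr => i /andP[_ light_i]; rewrite /class_size light_i.
  by apply: eq_bigr => i /andP[_ /negbTE light_i]; rewrite /class_size light_i.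
by move: #|A| #|_| A4 heavy3 => p q p4 q3; nia.
Qed.

Lemma andrasfai_edges (x y : nat) :
  (\sum_(i < 11) \sum_(j < 11) andrasfai_rel i j * (class_size x y i * class_size x y j) =
   2 * (12 * (x * x) + 8 * (x * y) + 2 * (y * y)))%N.
Proof.
under eq_bigr do rewrite !big_ord_recl big_ord0 /=.
rewrite !big_ord_recl big_ord0 /= /class_size /light_class /= /andrasfai_rel /andrasfai_adj /=.
nia.
Qed.

Lemma ex_tf_ge (n s : nat) : (4 * n <= 11 * s)%N -> (8 * s <= 3 * n)%N ->
  andrasfai_form n%:R s%:R <= (ex_tf n s)%:R :> rat.
Proof.
move=> lo hi.
have [x [y [yx nE sE]]] : exists x y, [/\ y <= x, n = 8 * x + 3 * y & s = 3 * x + y]%N.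
  by exists (3 * s - n)%N, (3 * n - 8 * s)%N; split; lia.
have := blowup_le_ex_tf andrasfai_sym andrasfai_triangle_free
  (fun A => @andrasfai_indep_weight x y A yx).
have -> : (\sum_(i < 11) class_size x y i = n)%N.
  by rewrite !big_ord_recl big_ord0 /class_size /light_class /= nE; lia.
rewrite -sE andrasfai_edges leq_pmul2l // -(ler_nat rat); apply: le_trans.
rewrite nE sE /andrasfai_form !natrD !natrM; move: (x%:R : rat) (y%:R : rat) => a b.
lra.
Qed.

Theorem theorem1p2 (n s : nat) (hsn : (s <= n)%N)
    (hlo : 4 * n%:Q / 11 <= s%:Q) (hhi : s%:Q <= 3 * n%:Q / 8) :
  (ex_tf n s)%:Z = 6 * n%:Z ^+ 2 - 32 * (n%:Z * s%:Z) + 44 * s%:Z ^+ 2.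
Proof.
have lo : (4 * n <= 11 * s)%N.
  by rewrite -(ler_nat rat) !natrM; move: hlo; rewrite -!pmulrn; lra.
have hi : (8 * s <= 3 * n)%N.
  by rewrite -(ler_nat rat) !natrM; move: hhi; rewrite -!pmulrn; lra.
apply: (intr_inj (R := rat)).
rewrite !(rmorphD, rmorphN, rmorphM, rmorphXn) /= -!pmulrn.
by apply: le_anti; rewrite ex_tf_le // ex_tf_ge.
Qed.
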